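(* Let $(V_o,w_o,\mu_o)$ be a simple weighted graph with an adapted weight $\sigma_o$ and associated adapted path metric $d_{\sigma_o}$, fix $\bar{x}\in V_o$, and let $(X^o_t)_{t\ge0}$ be the associated minimal Markov chain. Assume that \[C_o:=\inf_{x\in V_o}\mu_o(x)>0\] and that \[\int^{\infty}\frac{r\,dr}{\log\mu_o\big(B_{d_{\sigma_o}}(\bar{x},r)\big)}=\infty,\] where $\int^\infty$ means that the integral diverges at $\infty$. Then: (1) $(X^o_t)_{t\ge0}$ is conservative; (2) there exist constants $c>0$ and $\hat R\ge1$ such that the inverse function $\psi^{-1}(t)$ of \[\psi(R)=c\int_{\hat R}^{R}\frac{r\,dr}{\log\mu_o\big(B_{d_{\sigma_o}}(\bar{x},r)\big)+\log\log r}\] is an upper rate function for $(X^o_t)_{t\ge0}$ with respect to $d_{\sigma_o}$.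
   Context: A simple weighted graph $(V,w,\mu)$ consists of a countably infinite set $V$, a symmetric function $w:V\times V\to[0,\infty)$ and a function $\mu:V\to(0,\infty)$. The edge set is $E=\{(x,y):w(x,y)>0\}$, and one writes $x\sim y$ when $(x,y)\in E$. The graph $(V,E)$ is assumed to be locally finite, connected, undirected, and without loops or multiple edges. The associated Markov chain is the minimal continuous-time Markov chain with $Q$-matrix $q_{xy}=w(x,y)/\mu(x)$ for $x\neq y$ and $q_{xx}=-\frac{1}{\mu(x)}\sum_{y}w(x,y)$. Equivalently, it is the Hunt process of the minimal regular Dirichlet form on $L^2(V,\mu)$. It has lifetime $\zeta$ (the time of the accumulation of infinitely many jumps) and laws $\mathbb P_x$. The chain is conservative if $\mathbb P_x(\zeta<\infty)=0$ for all $x$. An adapted weight is a symmetric function $\sigma:E\to(0,1]$ with $\frac{1}{\mu(x)}\sum_{y}w(x,y)\sigma(x,y)^2\le1$ for all $x\in V$. The adapted path metric is \[d_\sigma(x,y)=\inf\Big\{\sum_{i=0}^{n-1}\sigma(x_i,x_{i+1})\Big\},\] where the infimum is over paths $x=x_0\sim x_1\sim\cdots\sim x_n=y$. Closed balls are $B_d(x,r)=\{y:d(x,y)\le r\}$. Given a reference point $\bar x$ and a metric $d$ on $V$, a nonnegative increasing function $R(t)$ is an upper rate function for the chain $(X_t)$ with respect to $d$ if there is a random time $T<\zeta$ with $\mathbb P_{\bar x}\big(d(X_t,\bar x)\le R(t)\text{ for all }T\le t<\zeta\big)=1$. *)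

(* Defs.v *)
From HB Require Import structures.
From mathcomp Require Import all_boot all_order all_algebra.
From mathcomp Require Import all_classical all_reals all_analysis.
Set Implicit Arguments. Unset Strict Implicit. Unset Printing Implicit Defensive.
Import Order.TTheory GRing.Theory Num.Theory.
Import numFieldNormedType.Exports.
Local Open Scope classical_set_scope.
Local Open Scope ring_scope.

Section Graph.
Variables (R : realType) (V : countType).

Definition walk (w : V -> V -> R) (x : V) (s : seq V) (y : V) : Prop :=
  path (fun a b => 0 < w a b) x s /\ last x s = y.

Fixpoint walk_length (sigma : V -> V -> R) (x : V) (s : seq V) : R :=
  match s with
  | [::] => 0
  | y :: s' => sigma x y + walk_length sigma y s'
  end.

Definition simple_weighted_graph (w : V -> V -> R) (mu : V -> R) : Prop :=
  ~ finite_set [set: V] /\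
  [/\ (forall x y, 0 <= w x y /\ w x y = w y x),
      (forall x, w x x = 0),
      (forall x, finite_set [set y | 0 < w x y]),
      (forall x y, exists s, walk w x s y) &
      (forall x, 0 < mu x)].

(* adapted weight sigma : E -> (0,1] (only its values on edges matter) *)
Definition adapted_weight (w : V -> V -> R) (mu : V -> R) (sigma : V -> V -> R)
  : Prop :=
  (forall x y, 0 < w x y -> [/\ 0 < sigma x y, sigma x y <= 1 &
                               sigma x y = sigma y x]) /\
  (forall x, (\esum_(y in [set: V]) ((w x y * sigma x y ^+ 2) / mu x)%:E
               <= 1)%E).

Definition adapted_dist (w sigma : V -> V -> R) (x y : V) : R :=
  inf [set l | exists s, walk w x s y /\ l = walk_length sigma x s].

Definition ball_d (d : V -> V -> R) (x : V) (r : R) : set V :=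
  [set y | d x y <= r].

Definition vol (mu : V -> R) (A : set V) : \bar R :=
  (\esum_(y in A) (mu y)%:E)%E.

(* weighted degree, jump probabilities and jump rates of the Q-matrix
   q_xy = w(x,y)/mu(x) *)
Definition wdeg (w : V -> V -> R) (x : V) : R :=
  fine (\esum_(y in [set: V]) (w x y)%:E)%E.
Definition jump_prob (w : V -> V -> R) (x y : V) : R := w x y / wdeg w x.
Definition jump_rate (w : V -> V -> R) (mu : V -> R) (x : V) : R :=
  wdeg w x / mu x.

Section Chain.
Context (d : measure_display) (Omega : measurableType d).

(* Minimal Markov chain started at x0, given by its jump-hold construction:
   Y = embedded discrete chain (transition jump_prob, Y_0 = x0),
   E = i.i.d. Exp(1) variables independent of Y; the n-th holding time is
   E_n / jump_rate (Y_n).  The law is prescribed through the joint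
   finite-dimensional distributions of (Y_0..Y_n, E_0..E_n). *)
Definition minimal_chain (w : V -> V -> R) (mu : V -> R) (x0 : V)
  (P : probability Omega R) (Y : nat -> Omega -> V) (E : nat -> Omega -> R)
  : Prop :=
  [/\ (forall n y, measurable [set om | Y n om = y]),
      (forall n, measurable_fun [set: Omega] (E n)) &
      (forall n (xs : nat -> V) (s : nat -> R), (forall i, 0 <= s i) ->
        P [set om | forall i, (i <= n)%N -> Y i om = xs i /\ s i < E i om] =
        ((xs 0%N == x0)%:R
          * \prod_(i < n) jump_prob w (xs i) (xs i.+1)
          * \prod_(i < n.+1) expR (- s i))%:E)].

Definition jump_time (w : V -> V -> R) (mu : V -> R)
  (Y : nat -> Omega -> V) (E : nat -> Omega -> R) (n : nat) (om : Omega) : R :=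
  \sum_(i < n) E i om / jump_rate w mu (Y i om).

Definition lifetime (w : V -> V -> R) (mu : V -> R)
  (Y : nat -> Omega -> V) (E : nat -> Omega -> R) (om : Omega) : \bar R :=
  ereal_sup [set (jump_time w mu Y E n om)%:E | n in [set: nat]].

(* X_t(om) = x  (for t < zeta(om)):  X_t = Y_n on [J_n, J_{n+1}) *)
Definition chain_at (w : V -> V -> R) (mu : V -> R)
  (Y : nat -> Omega -> V) (E : nat -> Omega -> R) (t : R) (om : Omega) (x : V)
  : Prop :=
  exists n, [/\ jump_time w mu Y E n om <= t,
               t < jump_time w mu Y E n.+1 om & Y n om = x].

Definition no_explosion (w : V -> V -> R) (mu : V -> R)
  (P : probability Omega R) (Y : nat -> Omega -> V) (E : nat -> Omega -> R)
  : Prop :=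
  exists A, [/\ measurable A, P A = 1%E &
                forall om, A om -> lifetime w mu Y E om = +oo%E].

Definition upper_rate_function (w : V -> V -> R) (mu : V -> R)
  (dist : V -> V -> R) (xbar : V)
  (P : probability Omega R) (Y : nat -> Omega -> V) (E : nat -> Omega -> R)
  (Rf : R -> R) : Prop :=
  (forall s t, 0 <= s -> s <= t -> 0 <= Rf s /\ Rf s <= Rf t) /\
  exists T : Omega -> R, measurable_fun [set: Omega] T /\
  exists A, [/\ measurable A, P A = 1%E &
     forall om, A om -> ((T om)%:E < lifetime w mu Y E om)%E /\
       forall t x, T om <= t -> ((t%:E < lifetime w mu Y E om)%E) ->
         chain_at w mu Y E t om x -> dist x xbar <= Rf t].

End Chain.
End Graph.

(* Main.v *)
Require Import Defs.
From HB Require Import structures.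
From mathcomp Require Import all_boot all_order all_algebra.
From mathcomp Require Import all_classical all_reals all_analysis.
From mathcomp Require Import finmap ring lra measurable_realfun.
Set Implicit Arguments. Unset Strict Implicit. Unset Printing Implicit Defensive.
Import Order.TTheory GRing.Theory Num.Theory.
Import numFieldNormedType.Exports.
Local Open Scope classical_set_scope.
Local Open Scope ring_scope.

(** Write [p] for the jump probabilities of the embedded chain Y, [h = mu/deg] for
    the mean holding times, [D] for the distance to [xbar] and [M_n] for
    [log mu(B(2^n)) + log log 2^n].  In the crossing of the n-th dyadic annulus,
    damp each jump x -> y by [exp(-s^2 sigma(x,y)^2) / (1 + 2 e s^2 h(x))] with
    [s] of order [M_n / 2^n].  The expected damping [v] is a subsolution of a
    symmetric equation with killing; testing it against [v phi^2],
    [phi = exp(s (rho - D)) - 1], costs only a constant on each edge because the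
    factor [exp(-s^2 sigma^2)] absorbs [(exp(s sigma) - 1)^2], however long the
    edge is compared to [1/s].  This gives [mu v^2 phi^2 <= mu(B(2^n))], hence [v]
    is tiny uniformly on the inner ball, as [mu] is bounded below.  By
    Borel-Cantelli, the sum of [sigma^2 + C h E] along all but finitely many
    crossings exceeds a multiple of [4^n / M_n].

    The [sigma^2] part is controlled by the elapsed time: since
    [sum_y p(x,y) sigma(x,y)^2 <= h(x)] and [sigma <= 1], the exponential of
    [sum sigma^2 - C h E] is a supermartingale, which is evaluated only at the
    exits from balls along which the accumulated bound grows by one.  Hence the
    exit time of B(2^n) is at least [2 psi(2^(n+1)) - K] for a random constant
    [K], and both claims follow. *)

(** * Elementary inequalities and the substitute for the exponential Laplace transform *)

Section Reals.
Variable R : realType.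
Implicit Types b z : R.

(** The law of the chain is prescribed only through the probabilities of [Y_i = x_i, E_i > s_i], so
    [exp(-b E)] is not integrated itself: it is dominated by a two-step function of [E], whose mean
    is a combination of such probabilities. Optimizing the step gives decay of order [b^(-1/2)]
    instead of [1/b]. The weight attached to a crossing is therefore the square root of the damping
    described above, and Jensen's inequality, applied one jump at a time, bounds its mean by
    [sqrt v]. The exponents are tuned to survive this: [phi] is at least [exp(8 M_n)/2] on the inner
    ball, so [v] is at most a multiple of [exp(-6 M_n)] and its root of [exp(-3 M_n)], while
    exponential Chebyshev at threshold [M_n] costs [exp(M_n)]. What remains is summable thanks to
    the [log log] in [M_n].

    The comparison of the sum of [sigma^2] with time fails with probability at most [exp(-T/2)] when
    the accumulated bound is [T]. Over all dyadic exits these numbers need not be summable, since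
    [T] may grow slowly with [n]; over the exits at which [T] passes successive integers they
    are. *)

Lemma expR_sub1_le z : expR z - 1 <= z * expR z.
Proof.
have h : 1 - z <= expR (- z) by have := expR_ge1Dx (- z).
have : (1 - z) * expR z <= expR (- z) * expR z by rewrite ler_wpM2r ?expR_ge0.
by rewrite -expRD addNr expR0; lra.
Qed.

Lemma expR1_ge2 : 2 <= expR 1 :> R.
Proof. by have := expR_ge1Dx (1 : R); lra. Qed.

(** Since [e^z - 1 <= z e^z] and [2 z - z^2 <= 1]. With [z = s sigma] this prices a jump of any
    length at [e s^2 sigma^2], the quantity that adaptedness sums. *)
Lemma expR_gauss_le z : 0 <= z ->
  expR (- z ^+ 2) * (expR z - 1) ^+ 2 <= expR 1 * z ^+ 2.
Proof.
move=> z0.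
have h0 : 0 <= expR z - 1 by have := expR_ge1Dx z; lra.
have h1 : (expR z - 1) ^+ 2 <= (z * expR z) ^+ 2.
  by rewrite ler_sqr ?nnegrE ?mulr_ge0 ?expR_ge0// expR_sub1_le.
apply: (le_trans (ler_wpM2l (expR_ge0 _) h1)).
have -> : expR (- z ^+ 2) * (z * expR z) ^+ 2 = expR (z + z - z ^+ 2) * z ^+ 2.
  by rewrite !expRD; ring.
rewrite ler_wpM2r ?sqr_ge0// ler_expR.
by have := sqr_ge0 (z - 1); rewrite sqrrB !expr2; lra.
Qed.

Lemma expR_le1D z : 0 <= z <= 1 -> expR z <= 1 + expR 1 * z.
Proof.
move=> /andP[z0 z1].
have h := expR_sub1_le z.
have : z * expR z <= z * expR 1 by rewrite ler_wpM2l// ler_expR.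
lra.
Qed.

(* [hold_factor b] bounds E[exp(-b E)] = 1/(1+b) for E ~ Exp(1); the exponent 1/2
   is what replacing E by a two-valued minorant costs for large [b]. *)
Definition hold_rate : R := 2 / (9 * expR 1).
Definition hold_factor b : R := (Num.sqrt (1 + hold_rate * b))^-1.

Lemma hold_rate_gt0 : 0 < hold_rate.
Proof. by rewrite divr_gt0// mulr_gt0// expR_gt0. Qed.

Lemma hold_rate_le : hold_rate <= 8^-1.
Proof.
rewrite /hold_rate ler_pdivrMr ?mulr_gt0 ?expR_gt0//.
by have := expR1_ge2; lra.
Qed.

Lemma hold_factor_gt0 b : 0 <= b -> 0 < hold_factor b.
Proof.
move=> b0; rewrite invr_gt0 sqrtr_gt0 ltr_pwDl//.
by rewrite mulr_ge0// ltW// hold_rate_gt0.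
Qed.

Lemma hold_factor_lt1 b : 0 < b -> hold_factor b < 1.
Proof.
move=> b0; have h : 0 < hold_rate * b by rewrite mulr_gt0// hold_rate_gt0.
rewrite /hold_factor invf_lt1 ?sqrtr_gt0; last lra.
by rewrite -{1}sqrtr1 ltr_sqrt; lra.
Qed.

Lemma hold_factor0 : hold_factor 0 = 1.
Proof. by rewrite /hold_factor mulr0 addr0 sqrtr1 invr1. Qed.

(** For [E ~ Exp(1)] the left side is the mean of the function equal to 1 where [E <= e] and to
    [exp(-b e)] beyond, which dominates [exp(-b E)]. *)
Lemma two_valued_laplace b : 0 <= b -> exists2 e : R, 0 <= e &
  1 - (1 - expR (- (b * e))) * expR (- e) <= hold_factor b.
Proof.
move=> b0; have r0 := hold_rate_gt0; have r1 := hold_rate_le.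
have rb0 : 0 <= hold_rate * b by rewrite mulr_ge0// ltW.
have s1 : 0 < 1 + hold_rate * b by lra.
have lesq u : 0 <= u -> u ^+ 2 * (1 + hold_rate * b) <= 1 -> u <= hold_factor b.
  move=> u0 hu; rewrite /hold_factor -[leRHS]mul1r ler_pdivlMr ?sqrtr_gt0//.
  rewrite -(@expr_le1 _ 2) ?mulr_ge0 ?sqrtr_ge0// exprMn sqr_sqrtr//.
  exact: ltW.
(* Large [b]: [e = 1/sqrt b] makes both error terms at most [1/sqrt b], and [hold_rate <= 1/8] gives
   [4/b * (1 + hold_rate b) <= 1]. *)
have [b8|b8] := leP 8 b.
  have q0 : 0 < Num.sqrt b by rewrite sqrtr_gt0; lra.
  have qq : Num.sqrt b ^+ 2 = b by rewrite sqr_sqrtr.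
  exists (Num.sqrt b)^-1; first by rewrite invr_ge0 ltW.
  have -> : b * (Num.sqrt b)^-1 = Num.sqrt b.
    by rewrite -{1}qq expr2 mulfK// gt_eqF.
  set q := Num.sqrt b in q0 qq *.
  have h1 : 1 - expR (- q^-1) <= q^-1 by have := expR_ge1Dx (- q^-1); lra.
  have h2 : expR (- q) <= q^-1.
    rewrite expRN lef_pV2 ?posrE ?expR_gt0//.
    by have := expR_ge1Dx q; lra.
  have h3 : expR (- q) * expR (- q^-1) <= q^-1.
    apply: le_trans h2; rewrite ler_piMr ?expR_ge0//.
    by rewrite -expR0 ler_expR oppr_le0 invr_ge0 ltW.
  have h4 : 1 - (1 - expR (- q)) * expR (- q^-1) <= 2 * q^-1 by lra.
  apply: (le_trans h4); apply: lesq; first by rewrite mulr_ge0// invr_ge0 ltW.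
  rewrite exprMn exprVn qq mulrAC ler_pdivrMr; last lra.
  have : hold_rate * b <= 8^-1 * b by rewrite ler_wpM2r.
  by rewrite !expr2; lra.
(* Small [b]: the 9 in [hold_rate] is [1 + b] at [b = 8], through
   [1 - exp(-b) >= b/(1 + b) >= b/9]. *)
exists 1 => //; rewrite mulr1.
have h1 : b / 9 <= 1 - expR (- b).
  have : expR (- b) <= (1 + b)^-1.
    by rewrite expRN lef_pV2 ?posrE ?expR_gt0 ?expR_ge1Dx//; lra.
  have : (1 + b)^-1 <= 1 - b / 9.
    rewrite -[leLHS]mul1r ler_pdivrMr; last lra.
    by nra.
  by lra.
have h2 : 1 - (1 - expR (- b)) * expR (- 1) <= 1 - hold_rate / 2 * b.
  have : b / 9 * expR (- 1) <= (1 - expR (- b)) * expR (- 1).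
    by rewrite ler_wpM2r ?expR_ge0.
  suff -> : hold_rate / 2 * b = b / 9 * expR (- 1) by lra.
  rewrite /hold_rate expRN; field.
  by rewrite gt_eqF ?expR_gt0.
apply: (le_trans h2).
have h3 : hold_rate * b < 1.
  have : hold_rate * b <= 8^-1 * b by rewrite ler_wpM2r.
  by lra.
apply: lesq; first lra.
set x := hold_rate * b in rb0 h3 *.
have -> : hold_rate / 2 * b = x / 2 by rewrite /x; ring.
have -> : (1 - x / 2) ^+ 2 * (1 + x) = 1 - x ^+ 2 * (3 - x) / 4 by field.
have : 0 <= x ^+ 2 * (3 - x) / 4.
  by rewrite divr_ge0// mulr_ge0 ?sqr_ge0//; lra.
lra.
Qed.

End Reals.

(** * Locally finite weighted graphs and the adapted path metric *)

Section WeightedGraph.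
Variables (R : realType) (V : countType).
Variables (w : V -> V -> R) (mu : V -> R) (sigma : V -> V -> R) (xbar : V).
Hypothesis graph_w : simple_weighted_graph w mu.
Hypothesis adapted_sigma : adapted_weight w mu sigma.
Implicit Types x y : V.

Definition nbhd x : {fset V} := fset_set [set y | 0 < w x y].

Lemma weight_ge0 x y : 0 <= w x y.
Proof. by case: graph_w => _ [/(_ x y)[]]. Qed.

Lemma weightC x y : w x y = w y x.
Proof. by case: graph_w => _ [/(_ x y)[]]. Qed.

Lemma mass_gt0 x : 0 < mu x.
Proof. by case: graph_w => _ []. Qed.

Lemma mem_nbhd x y : (y \in nbhd x) = (0 < w x y).
Proof.
rewrite in_fset_set; last by case: graph_w => _ [].
by apply/idP/idP => [/set_mem//|h]; exact/mem_set.
Qed.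

Lemma weight_notin_nbhd x y : y \notin nbhd x -> w x y = 0.
Proof.
rewrite mem_nbhd -leNgt => h; apply/eqP.
by rewrite eq_le h weight_ge0.
Qed.

Lemma esum_nbhd x (f : V -> R) : (forall y, 0 <= f y) ->
  (forall y, y \notin nbhd x -> f y = 0) ->
  (\esum_(y in [set: V]) (f y)%:E = (\sum_(y <- nbhd x) f y)%:E)%E.
Proof.
move=> f0 fN; have fin : finite_set [set y | 0 < w x y] by case: graph_w => _ [].
rewrite [LHS](_ : _ = \esum_(y in [set y | 0 < w x y]) (f y)%:E); last first.
  rewrite [RHS]esum_mkcond; apply: eq_esum => y _.
  case: ifPn => //; rewrite -(in_fset_set fin) => yN.
  by rewrite fN.
rewrite esum_fset//; last by move=> y _; rewrite lee_fin.
by rewrite fsbig_finite//= -sumEFin.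
Qed.

Lemma wdegE x : wdeg w x = \sum_(y <- nbhd x) w x y.
Proof.
rewrite /wdeg (@esum_nbhd x)//; first by move=> y; exact: weight_ge0.
exact: weight_notin_nbhd.
Qed.

Lemma wdeg_gt0 x : 0 < wdeg w x.
Proof.
have [y xy] : exists y, y != x.
  apply: contrapT => /forallNP h; case: graph_w => Vinf _; apply: Vinf.
  apply: (@sub_finite_set _ _ [set x]) (finite_set1 x) => y _ /=.
  by have := h y; move/negP; rewrite negbK => /eqP.
have [s [ps ls]] : exists s, walk w x s y by case: graph_w => _ [].
case: s ps ls => [_ /= e|z s /= /andP[xz _] _]; first by rewrite e eqxx in xy.
rewrite wdegE (big_rem z) ?mem_nbhd//=; apply: ltr_pwDl => //.
by apply: sumr_ge0 => u _; exact: weight_ge0.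
Qed.

Lemma sigma_gt0 x y : 0 < w x y -> 0 < sigma x y.
Proof. by case: adapted_sigma => h _ /h[]. Qed.

Lemma sigma_le1 x y : 0 < w x y -> sigma x y <= 1.
Proof. by case: adapted_sigma => h _ /h[]. Qed.

Lemma sigmaC x y : 0 < w x y -> sigma x y = sigma y x.
Proof. by case: adapted_sigma => h _ /h[]. Qed.

Lemma sum_weight_sigma2_le x :
  \sum_(y <- nbhd x) w x y * sigma x y ^+ 2 <= mu x.
Proof.
case: adapted_sigma => _ /(_ x); rewrite (@esum_nbhd x).
- by rewrite lee_fin -mulr_suml ler_pdivrMr ?mass_gt0// mul1r.
- move=> y; apply: divr_ge0; last exact/ltW/mass_gt0.
  by rewrite mulr_ge0 ?weight_ge0 ?sqr_ge0.
- by move=> y /weight_notin_nbhd ->; rewrite !mul0r.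
Qed.

Lemma jump_prob_ge0 x y : 0 <= jump_prob w x y.
Proof. by rewrite divr_ge0 ?weight_ge0// ltW// wdeg_gt0. Qed.

Lemma sum_jump_prob x : \sum_(y <- nbhd x) jump_prob w x y = 1.
Proof. by rewrite -mulr_suml -wdegE divff// gt_eqF// wdeg_gt0. Qed.

Definition mean_hold x : R := mu x / wdeg w x.

Lemma mean_hold_gt0 x : 0 < mean_hold x.
Proof. by rewrite divr_gt0 ?mass_gt0 ?wdeg_gt0. Qed.

Lemma jump_rateV x : (jump_rate w mu x)^-1 = mean_hold x.
Proof. by rewrite /jump_rate invf_div. Qed.

Lemma sum_jump_prob_sigma2_le x :
  \sum_(y <- nbhd x) jump_prob w x y * sigma x y ^+ 2 <= mean_hold x.
Proof.
under eq_bigr do rewrite /jump_prob mulrAC.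
by rewrite -mulr_suml ler_pM2r ?invr_gt0 ?wdeg_gt0// sum_weight_sigma2_le.
Qed.

Local Notation dist := (adapted_dist w sigma).
Local Notation D := (dist xbar).

Lemma walk_length_ge0 x s y : walk w x s y -> 0 <= walk_length sigma x s.
Proof.
elim: s x => [|z s IH] x [] //= /andP[xz ps] ls.
by rewrite addr_ge0 ?IH// ltW// sigma_gt0.
Qed.

Lemma dist_has_inf x y :
  has_inf [set l | exists s, walk w x s y /\ l = walk_length sigma x s].
Proof.
split.
  have [s ws] : exists s, walk w x s y by case: graph_w => _ [].
  by exists (walk_length sigma x s), s.
by exists 0 => l [s [ws ->]]; exact: walk_length_ge0 ws.
Qed.

Lemma dist_ge0 x y : 0 <= dist x y.
Proof.
apply: lb_le_inf; first by case: (dist_has_inf x y).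
by move=> l [s [ws ->]]; exact: walk_length_ge0 ws.
Qed.

Lemma dist_edge x y z : 0 < w y z -> dist x z <= dist x y + sigma y z.
Proof.
move=> yz; rewrite -lerBlDr; apply: lb_le_inf; first by case: (dist_has_inf x y).
move=> l [s [[ps ls] ->]]; rewrite lerBlDr; apply: ge_inf.
  by case: (dist_has_inf x z).
exists (rcons s z); split.
  by split; rewrite ?rcons_path ?ls ?ps ?yz ?last_rcons.
elim: s x {ps} ls => [|u s IH] x /= ls; first by rewrite ls addr0 add0r.
by rewrite -(IH _ ls) addrA.
Qed.

Lemma dist_edge1 x y z : 0 < w y z -> dist x z <= dist x y + 1.
Proof.
move=> yz; apply: le_trans (dist_edge x yz) _.
by rewrite lerD2l sigma_le1.
Qed.

Lemma dist_le_sym x y : dist x y <= dist y x.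
Proof.
apply: lb_le_inf; first by case: (dist_has_inf y x).
move=> l [s [[ps ls] ->]]; apply: ge_inf; first by case: (dist_has_inf x y).
exists (rev (belast y s)); split.
  split; last by case: s ls {ps} => //= z s _; rewrite rev_cons last_rcons.
  rewrite -ls rev_path; apply: sub_path ps => a b /=.
  by rewrite weightC.
elim: s y ps ls => [|z s IH] y //= /andP[yz ps] ls.
rewrite rev_cons (IH _ ps ls) sigmaC//.
have : last x (rev (belast z s)) = z.
  by case: s ls {ps IH} => //= u s _; rewrite rev_cons last_rcons.
elim: (rev _) x {IH ls ps} => [|u t IH] x /= lt; first by rewrite lt !addr0.
by rewrite -(IH _ lt); ring.
Qed.

Lemma distC x y : dist x y = dist y x.
Proof. by apply/eqP; rewrite eq_le !dist_le_sym. Qed.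

(** Masses of at least [c] leave room for fewer than [N] vertices in a volume below [c N]. Finite
    balls make the energy argument a finite computation, and bound the mean holding times from below
    on a trajectory that stays in a ball. *)
Lemma ball_finite (c r : R) : 0 < c -> (forall x, c <= mu x) ->
  (vol mu (ball_d dist xbar r) < +oo)%E -> finite_set (ball_d dist xbar r).
Proof.
move=> c0 cmu; rewrite /vol => volB; apply: contrapT => Binf.
have [N volN] : exists N : nat, (vol mu (ball_d dist xbar r) < (c * N%:R)%:E)%E.
  have vol0 : (0 <= vol mu (ball_d dist xbar r))%E.
    by apply: esum_ge0 => x _; rewrite lee_fin ltW// mass_gt0.
  have [q q0 qE] : exists2 q : R, 0 <= q & vol mu (ball_d dist xbar r) = q%:E.
    exists (fine (vol mu (ball_d dist xbar r))); first exact: fine_ge0.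
    by rewrite fineK// ge0_fin_numE.
  exists (Num.bound (q / c)); rewrite qE lte_fin mulrC -ltr_pdivrMr//.
  by rewrite archi_boundP// divr_ge0// ltW.
have [B' BB' cB'] := @infinite_set_fset _ (ball_d dist xbar r) N Binf.
move: volN; apply/negP; rewrite -leNgt; apply: esum_ge.
exists [set` B']; first by split => //; exact: BB'.
rewrite fsbig_finite//= set_fsetK sumEFin lee_fin.
apply: (@le_trans _ _ (\sum_(y <- B') c)); last by apply: ler_sum => y _.
rewrite big_const_seq count_predT iter_addr_0 -[leRHS]mulr_natr.
by apply: ler_wpM2l; [exact: ltW|rewrite ler_nat].
Qed.

Lemma vol_finite (A : set V) : finite_set A ->
  vol mu A = (\sum_(x <- fset_set A) mu x)%:E.
Proof.
move=> fA; rewrite /vol esum_fset//; last first.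
  by move=> x _; rewrite lee_fin ltW// mass_gt0.
by rewrite fsbig_finite//= sumEFin.
Qed.

End WeightedGraph.

(** * Weighted L2 estimate for subsolutions with killing *)

Section Caccioppoli.
Variables (R : realType) (V : countType).
Variables (w : V -> V -> R) (mu : V -> R) (sigma : V -> V -> R) (xbar : V).
Hypothesis graph_w : simple_weighted_graph w mu.
Hypothesis adapted_sigma : adapted_weight w mu sigma.
Local Notation D := (adapted_dist w sigma xbar).
Variables (s rho : R) (v : V -> R).
Hypothesis s_gt0 : 0 < s.
Hypothesis v01 : forall x, 0 <= v x <= 1.
Hypothesis v_sub : forall x, D x <= rho ->
  v x * (wdeg w x + 2 * expR 1 * s ^+ 2 * mu x) <=
  \sum_(y <- nbhd w x) w x y * expR (- (s * sigma x y) ^+ 2) * v y.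
Hypothesis fin_ball : finite_set (ball_d (adapted_dist w sigma) xbar (rho + 1)).
Local Notation U := (fset_set (ball_d (adapted_dist w sigma) xbar (rho + 1))).

(** The damped weight [W] is symmetric, unlike the jump probabilities, so sums over edges can be
    symmetrized. Cutting the exponential off at 1 makes [phi] vanish outside the ball of radius
    [rho] and keeps the multiplicative control of [psi] along edges. *)
Let W x y := w x y * expR (- (s * sigma x y) ^+ 2).
Let psi x := Num.max 1 (expR (s * (rho - D x))).
Let phi x := psi x - 1.

Let W_ge0 x y : 0 <= W x y.
Proof. by rewrite mulr_ge0 ?expR_ge0// (weight_ge0 graph_w). Qed.

Let WC x y : W x y = W y x.
Proof.
rewrite /W (weightC graph_w x y); have [yx|] := ltP 0 (w y x).
  by rewrite (sigmaC adapted_sigma yx).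
rewrite le_eqVlt ltNge (weight_ge0 graph_w) orbF => /eqP ->.
by rewrite !mul0r.
Qed.

Let mem_U x : (x \in U) = (D x <= rho + 1).
Proof.
rewrite in_fset_set//; apply/idP/idP => [/set_mem//|h]; exact/mem_set.
Qed.

Let psi_ge1 x : 1 <= psi x.
Proof. by rewrite /psi le_max lexx. Qed.

Let psi_edge x y : 0 < w x y -> psi y <= psi x * expR (s * sigma x y).
Proof.
move=> xy; have sg := sigma_gt0 adapted_sigma xy.
have e1 : 1 <= expR (s * sigma x y) by rewrite -expR0 ler_expR mulr_ge0 ?ltW.
rewrite {1}/psi ge_max; apply/andP; split.
  apply: le_trans (psi_ge1 x) _; rewrite ler_peMr//.
  exact: le_trans (psi_ge1 x).
apply: (@le_trans _ _ (expR (s * (rho - D x)) * expR (s * sigma x y))).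
  rewrite -expRD ler_expR -mulrDr ler_pM2l//.
  have yx : 0 < w y x by rewrite (weightC graph_w).
  have := dist_edge graph_w adapted_sigma xbar yx.
  by rewrite (sigmaC adapted_sigma yx); lra.
by rewrite ler_wpM2r ?expR_ge0// /psi le_max lexx orbT.
Qed.

(** The multiplicative bound on [psi], used in both directions of the edge, gives [|phi x - phi y|
    <= psi x (exp(s sigma) - 1)]; the Gaussian factor of [W] absorbs the square. *)
Let phi_edge x y :
  W x y * (phi x - phi y) ^+ 2 <=
  expR 1 * s ^+ 2 * psi x ^+ 2 * (w x y * sigma x y ^+ 2).
Proof.
have [xy|] := ltP 0 (w x y); last first.
  rewrite le_eqVlt ltNge (weight_ge0 graph_w) orbF => /eqP wxy.
  by rewrite /W wxy !mul0r mulr0.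
have sg : 0 <= s * sigma x y by rewrite mulr_ge0 ?ltW// (sigma_gt0 adapted_sigma xy).
have px : 0 <= psi x by exact: le_trans (psi_ge1 x).
have h1 : (phi x - phi y) ^+ 2 <= (psi x * (expR (s * sigma x y) - 1)) ^+ 2.
  have e1 : 1 <= expR (s * sigma x y) by rewrite -expR0 ler_expR.
  rewrite -[leLHS]real_normK ?num_real// ler_sqr ?nnegrE ?normr_ge0//; last first.
    by rewrite mulr_ge0// subr_ge0.
  have yx : 0 < w y x by rewrite (weightC graph_w).
  have h1 := psi_edge xy; have h2 := psi_edge yx.
  rewrite -(sigmaC adapted_sigma xy) in h2.
  rewrite /phi ler_norml; apply/andP; split; first lra.
  have [le_yx|/ltW le_xy] := leP (psi y) (psi x); last first.
    have : 0 <= psi x * (expR (s * sigma x y) - 1) by rewrite mulr_ge0// subr_ge0.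
    by lra.
  have : psi y * (expR (s * sigma x y) - 1) <= psi x * (expR (s * sigma x y) - 1).
    by rewrite ler_wpM2r// subr_ge0.
  by lra.
apply: (le_trans (ler_wpM2l (W_ge0 x y) h1)).
have := expR_gauss_le sg; rewrite /W => h2.
have h3 : 0 <= w x y * psi x ^+ 2 by rewrite mulr_ge0 ?sqr_ge0 ?(weight_ge0 graph_w).
have := ler_wpM2l h3 h2.
congr (_ <= _); ring.
Qed.

Let nbhd_sub_U x : D x <= rho -> (nbhd w x `<=` U)%fset.
Proof.
move=> xr; apply/fsubsetP => y; rewrite (mem_nbhd graph_w) mem_U => xy.
by have := dist_edge1 graph_w adapted_sigma xbar xy; lra.
Qed.

Let sum_nbhd_U x (f : V -> R) : D x <= rho ->
  \sum_(y <- nbhd w x) W x y * f y = \sum_(y <- U) W x y * f y.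
Proof.
move=> xr; apply: big_fset_incl; first exact: nbhd_sub_U.
by move=> y _ /(weight_notin_nbhd graph_w) wxy; rewrite /W wxy !mul0r.
Qed.

Let sum_weight_U x : \sum_(y <- U) w x y * sigma x y ^+ 2 <= mu x.
Proof.
apply: le_trans (sum_weight_sigma2_le graph_w adapted_sigma x).
rewrite [leRHS](@big_fset_incl _ _ _ _ _ (nbhd w x `|` U)%fset) //=; last first.
- by move=> y _ /(weight_notin_nbhd graph_w) ->; rewrite mul0r.
- exact: fsubsetUl.
rewrite [leRHS](bigID (fun y => y \in U)) /= -[X in X <= _]addr0.
apply: lerD; last first.
  by apply: sumr_ge0 => y _; rewrite mulr_ge0 ?sqr_ge0// (weight_ge0 graph_w).
rewrite le_eqVlt; apply/orP; left; apply/eqP.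
rewrite -[RHS]big_filter; apply: perm_big.
apply: uniq_perm; rewrite ?filter_uniq ?fset_uniq// => y.
by rewrite mem_filter inE orbC; case: (y \in U).
Qed.

Let phi0 x : rho < D x -> phi x = 0.
Proof.
move=> xr; rewrite /phi /psi max_l ?subrr//.
by rewrite -expR0 ler_expR pmulr_rle0// subr_le0 ltW.
Qed.

Let local_ineq x :
  v x * phi x ^+ 2 * (\sum_(y <- U) W x y * (v x - v y)) +
    2 * expR 1 * s ^+ 2 * (mu x * (v x * phi x) ^+ 2) <= 0.
Proof.
have [xr|xr] := leP (D x) rho; last first.
  by rewrite phi0// expr0n/= !mulr0 mul0r expr0n/= !mulr0 addr0.
have /andP[v0 v1] := v01 x.
have h := v_sub xr; rewrite (sum_nbhd_U v xr) in h.
(* As [W <= w], the weight removed by the damping acts as additional killing, which is dropped. *)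
have hw : \sum_(y <- U) W x y * v x <= v x * wdeg w x.
  rewrite -(sum_nbhd_U (fun=> v x) xr) -mulr_suml mulrC ler_wpM2l//.
  rewrite (wdegE graph_w); apply: ler_sum => y _.
  rewrite /W ler_piMr ?(weight_ge0 graph_w)// -expR0 ler_expR.
  by rewrite oppr_le0 sqr_ge0.
under eq_bigr do rewrite mulrBr.
rewrite sumrB.
set A := \sum_(y <- U) W x y * v x in hw *.
set B := \sum_(y <- U) W x y * v y in h *.
have h2 : v x * phi x ^+ 2 * (A - B + 2 * expR 1 * s ^+ 2 * mu x * v x) <= 0.
  apply: mulr_ge0_le0; first by rewrite mulr_ge0 ?sqr_ge0.
  by lra.
rewrite (_ : _ + _ = v x * phi x ^+ 2 * (A - B + 2 * expR 1 * s ^+ 2 * mu x * v x))//.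
by ring.
Qed.

(** The right side is a square minus [a b (al - be)^2], and [2 a b <= a^2 + b^2]. Summed over
    symmetric weights, this leaves only the increments of the cutoff. *)
Let pair_ineq (a b al be : R) :
  - ((a ^+ 2 + b ^+ 2) * (al - be) ^+ 2) / 2 <=
  a * al ^+ 2 * (a - b) + b * be ^+ 2 * (b - a).
Proof.
have -> : a * al ^+ 2 * (a - b) + b * be ^+ 2 * (b - a) =
  (a * al - b * be) ^+ 2 - a * b * (al - be) ^+ 2 by ring.
have h1 := sqr_ge0 (a * al - b * be).
have h2 : 0 <= (a - b) ^+ 2 * (al - be) ^+ 2 by rewrite mulr_ge0 ?sqr_ge0.
have h3 : (a - b) ^+ 2 * (al - be) ^+ 2 =
  (a ^+ 2 + b ^+ 2) * (al - be) ^+ 2 - 2 * (a * b * (al - be) ^+ 2) by ring.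
lra.
Qed.

(** With [X] and [Y] the two sides, the killing gives [2 e s^2 X <= - S1 <= Q / 2], while
    [psi = phi + 1] and [v <= 1] give [Q <= 2 e s^2 (X + Y)]. The factor 2 in the killing rate is
    what leaves [X <= Y] after absorption. *)
Lemma weighted_l2_bound : \sum_(x <- U) mu x * (v x * phi x) ^+ 2 <= \sum_(x <- U) mu x.
Proof.
set X := (X in X <= _); set Y := (Y in _ <= Y).
pose S1 := \sum_(x <- U) \sum_(y <- U) W x y * (v x * phi x ^+ 2 * (v x - v y)).
pose Q := \sum_(x <- U) \sum_(y <- U) W x y * (v x ^+ 2 * (phi x - phi y) ^+ 2).
have h1 : S1 + 2 * expR 1 * s ^+ 2 * X <= 0.
  rewrite /S1 /X mulr_sumr -big_split/=; apply: sumr_le0 => x _.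
  apply: le_trans (local_ineq x); rewrite lerD2r mulr_sumr.
  by rewrite le_eqVlt; apply/orP; left; apply/eqP; apply: eq_bigr => y _; ring.
have h2 : - Q <= 2 * S1.
  have S1E : 2 * S1 = \sum_(x <- U) \sum_(y <- U) W x y *
      (v x * phi x ^+ 2 * (v x - v y) + v y * phi y ^+ 2 * (v y - v x)).
    rewrite mulr_natl mulr2n {2}/S1 exchange_big/= -big_split/=.
    apply: eq_bigr => x _; rewrite -big_split/=; apply: eq_bigr => y _.
    by rewrite (WC y x) -mulrDr.
  have QE : - Q = \sum_(x <- U) \sum_(y <- U) W x y *
      (- ((v x ^+ 2 + v y ^+ 2) * (phi x - phi y) ^+ 2) / 2).
    rewrite (_ : - Q = - (Q + Q) / 2); last by lra.
    rewrite {2}/Q exchange_big/= -big_split/= -sumrN mulr_suml.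
    apply: eq_bigr => x _; rewrite -big_split/= -sumrN mulr_suml.
    by apply: eq_bigr => y _; rewrite (WC y x); field.
  rewrite S1E QE; apply: ler_sum => x _; apply: ler_sum => y _.
  by rewrite ler_wpM2l// pair_ineq.
have h3 : Q <= 2 * expR 1 * s ^+ 2 * (X + Y).
  rewrite /Q /X /Y -big_split/= mulr_sumr; apply: ler_sum => x _.
  have /andP[v0 v1] := v01 x.
  apply: (@le_trans _ _ (v x ^+ 2 * (expR 1 * s ^+ 2 * psi x ^+ 2 * mu x))).
    under eq_bigr do rewrite mulrCA.
    rewrite -mulr_sumr ler_wpM2l ?sqr_ge0//.
    apply: (@le_trans _ _ (\sum_(y <- U)
        expR 1 * s ^+ 2 * psi x ^+ 2 * (w x y * sigma x y ^+ 2))).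
      by apply: ler_sum => y _; exact: phi_edge.
    rewrite -mulr_sumr; apply: ler_wpM2l; last exact: sum_weight_U.
    by rewrite mulr_ge0 ?sqr_ge0// mulr_ge0 ?expR_ge0 ?sqr_ge0.
  have -> : v x ^+ 2 * (expR 1 * s ^+ 2 * psi x ^+ 2 * mu x) =
      expR 1 * s ^+ 2 * mu x * (v x * psi x) ^+ 2 by ring.
  have -> : 2 * expR 1 * s ^+ 2 * (mu x * (v x * phi x) ^+ 2 + mu x) =
      expR 1 * s ^+ 2 * mu x * (2 * ((v x * phi x) ^+ 2 + 1)) by ring.
  apply: ler_wpM2l.
    apply: mulr_ge0; last exact/ltW/(mass_gt0 graph_w).
    by rewrite mulr_ge0 ?expR_ge0 ?sqr_ge0.
  have -> : v x * psi x = v x * phi x + v x by rewrite /phi; ring.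
  have h4 := sqr_ge0 (v x * phi x - v x).
  have h5 : v x ^+ 2 <= 1 by rewrite expr_le1.
  have -> : (v x * phi x + v x) ^+ 2 = 2 * (v x * phi x) ^+ 2 + 2 * v x ^+ 2 -
     (v x * phi x - v x) ^+ 2 by ring.
  by lra.
have c0 : 0 < expR 1 * s ^+ 2 by rewrite mulr_gt0 ?expR_gt0 ?exprn_gt0.
have : expR 1 * s ^+ 2 * X <= expR 1 * s ^+ 2 * Y.
  have e1 : 2 * expR 1 * s ^+ 2 * (X + Y) =
    2 * (expR 1 * s ^+ 2 * X) + 2 * (expR 1 * s ^+ 2 * Y) by ring.
  have e2 : 2 * expR 1 * s ^+ 2 * X = 2 * (expR 1 * s ^+ 2 * X) by ring.
  by rewrite e1 in h3; rewrite e2 in h1; lra.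
by rewrite ler_pM2l.
Qed.

Lemma pointwise_l2_bound x : D x <= rho ->
  mu x * (v x * (expR (s * (rho - D x)) - 1)) ^+ 2 <= \sum_(y <- U) mu y.
Proof.
move=> xr; apply: le_trans weighted_l2_bound.
have xU : x \in U by rewrite mem_U; lra.
rewrite (big_rem x)//= /phi /psi max_r; last first.
  by rewrite -expR0 ler_expR; apply: mulr_ge0; [exact: ltW|rewrite subr_ge0].
rewrite lerDl; apply: sumr_ge0 => y _.
by rewrite mulr_ge0 ?sqr_ge0// ltW// (mass_gt0 graph_w).
Qed.

End Caccioppoli.

(** * Measurability of quantified events; changing one coordinate of a product *)

Section MeasurableQuantifiers.
Context (d : measure_display) (T : measurableType d).

Lemma measurable_forall (F : nat -> set T) : (forall i, measurable (F i)) ->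
  measurable [set om | forall i, F i om].
Proof.
move=> mF; rewrite (_ : [set om | _] = \bigcap_i F i).
  exact: bigcapT_measurable.
by apply/seteqP; split => om h i //; exact: h.
Qed.

Lemma measurable_exists (F : nat -> set T) : (forall i, measurable (F i)) ->
  measurable [set om | exists i, F i om].
Proof.
move=> mF; rewrite (_ : [set om | _] = \bigcup_i F i).
  exact: bigcupT_measurable.
by apply/seteqP; split => om [i]; [exists i|move=> _ h; exists i].
Qed.

Lemma measurable_imply (p : Prop) (A : set T) : measurable A ->
  measurable [set om | p -> A om].
Proof.
move=> mA; have [hp|hp] := pselect p.
  by rewrite (_ : [set om | _] = A)//; apply/seteqP; split => om h //; exact: h.
by rewrite (_ : [set om | _] = setT)//; apply/seteqP; split => om // _ /hp.
Qed.

Lemma measurable_and (A B : set T) : measurable A -> measurable B ->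
  measurable [set om | A om /\ B om].
Proof. by move=> mA mB; exact: measurableI. Qed.

End MeasurableQuantifiers.

Section ProductUpdate.
Variable R : realType.

Definition upd (t : nat -> R) m u : nat -> R := fun j => if j == m then u else t j.

(** One step in expanding a product of differences. It is used twice, for products of indicators and
    for products of their means, so that both sides of the integral identity obey the same
    recursion. *)
Lemma prod_upd n m (A t : nat -> R) (B : nat -> R -> R) u u' c : (m < n)%N ->
  A m = B m u - c * B m u' ->
  \prod_(j < n) (if (j < m.+1)%N then A j else B j (t j)) =
  \prod_(j < n) (if (j < m)%N then A j else B j (upd t m u j)) -
  c * \prod_(j < n) (if (j < m)%N then A j else B j (upd t m u' j)).
Proof.
move=> mn Am; pose o := Ordinal mn.
rewrite (bigD1 o)//= [X in _ = X - _](bigD1 o)//= [X in _ = _ - _ * X](bigD1 o)//=.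
rewrite ltnSn ltnn /upd eqxx Am.
have e v : \prod_(i < n | i != o) (if (i < m)%N then A i else
    B i (if i == m :> nat then v else t i)) =
   \prod_(i < n | i != o) (if (i < m.+1)%N then A i else B i (t i)).
  apply: eq_bigr => j jo; rewrite ltnS [(j <= m)%N]leq_eqVlt.
  have /negbTE -> : (j : nat) != m by [].
  by [].
by rewrite !e; ring.
Qed.

End ProductUpdate.

(** * Exponential Chebyshev bound along a fixed path *)

Section Chain.
Variables (R : realType) (V : countType).
Variables (w : V -> V -> R) (mu : V -> R) (x0 : V).
Context (d : measure_display) (Omega : measurableType d).
Variables (P : probability Omega R) (Y : nat -> Omega -> V) (E : nat -> Omega -> R).
Hypothesis chain : minimal_chain w mu x0 P Y E.

Fixpoint path_prob x (s : seq V) : R :=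
  if s is y :: s' then jump_prob w x y * path_prob y s' else 1.

Definition cylinder x (s : seq V) : set Omega :=
  [set om | forall i, (i <= size s)%N -> Y i om = nth x (x :: s) i].

Definition holds_beyond j (t : R) : set Omega := [set om | t < E j om].

Definition holds_positive : set Omega := [set om | forall j, 0 < E j om].

Lemma measurable_pos_at n y : measurable [set om | Y n om = y].
Proof. by case: chain. Qed.

Lemma measurable_hold j : measurable_fun setT (E j).
Proof. by case: chain. Qed.

Lemma measurable_holds_beyond j t : measurable (holds_beyond j t).
Proof.
have := measurable_hold j measurableT (measurable_itv `]t, +oo[).
rewrite setTI; congr measurable; apply/seteqP; split => om /=;
  by rewrite /holds_beyond/= in_itv/= andbT.
Qed.

Lemma measurable_holds_positive : measurable holds_positive.
Proof. by apply: measurable_forall => j; exact: measurable_holds_beyond. Qed.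

Lemma measurable_cylinder x s : measurable (cylinder x s).
Proof.
apply: measurable_forall => i; apply: measurable_imply; exact: measurable_pos_at.
Qed.

Lemma path_prob_prod x s :
  path_prob x s = \prod_(i < size s) jump_prob w (nth x (x :: s) i) (nth x (x :: s) i.+1).
Proof.
elim: s x => [|y s IH] x /=; first by rewrite big_ord0.
rewrite big_ord_recl/= IH; congr (_ * _); apply: eq_bigr => i _.
rewrite !add0n; case: i => i hi.
by congr jump_prob; apply: set_nth_default => //=; rewrite ltnS// ltnW.
Qed.

Lemma cylinder_prob s (t : nat -> R) : (forall i, 0 <= t i) ->
  P (cylinder x0 s `&` [set om | forall j, (j <= size s)%N -> holds_beyond j (t j) om])
  = (path_prob x0 s * \prod_(j < (size s).+1) expR (- t j))%:E.
Proof.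
move=> t0; case: chain => _ _ /(_ (size s) (nth x0 (x0 :: s)) t t0).
rewrite /= eqxx mul1r -(path_prob_prod x0 s) => <-; congr (P _).
apply/seteqP; split => om /=.
  by move=> [h1 h2] i hi; split; [exact: h1|exact: h2].
by move=> h; split => i hi; have [] := h _ hi.
Qed.

Section Laplace.
Variables (s : seq V) (b e : nat -> R).
Hypothesis b_ge0 : forall j, 0 <= b j.
Hypothesis e_ge0 : forall j, 0 <= e j.
Let n := size s.
Let c j := 1 - expR (- (b j * e j)).
(** [g] dominates [exp(-b E)] where [E > 0], and [q] is its mean; in [F m] the first [m] tail
    indicators have been replaced by [g]. *)
Let g j om : R := \1_(holds_beyond j 0) om - c j * \1_(holds_beyond j (e j)) om.
Let q j := 1 - c j * expR (- e j).
Let F m (t : nat -> R) om : R := \prod_(j < n.+1)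
  (if (j < m)%N then g j om else \1_(holds_beyond j (t j)) om).

Let c_ge0 j : 0 <= c j.
Proof. by rewrite subr_ge0 -expR0 ler_expR oppr_le0 mulr_ge0. Qed.

Let c_le1 j : c j <= 1.
Proof. by rewrite lerBlDr lerDl expR_ge0. Qed.

Let indic01 (A : set Omega) om : 0 <= (\1_A om : R) <= 1.
Proof. by rewrite indicE; case: (om \in A); rewrite ?lexx ?ler01. Qed.

Let g01 j om : 0 <= g j om <= 1.
Proof.
rewrite /g !indicE; case: (boolP (om \in holds_beyond j (e j))) => h /=.
  rewrite mem_set ?mulr1; last first.
    by move/set_mem: h; apply: le_lt_trans.
  by have := c_ge0 j; have := c_le1 j => /=; lra.
by rewrite mulr0 subr0; case: (om \in _); rewrite ?lexx ?ler01.
Qed.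

Let F01 m t om : 0 <= F m t om <= 1.
Proof.
rewrite /F; elim/big_ind : _ => [|x y /andP[x0' x1] /andP[y0 y1]|j _].
- by rewrite ler01 lexx.
- by rewrite mulr_ge0// mulr_ile1.
- by case: ifP.
Qed.

Let measurable_F m t : measurable_fun setT (F m t).
Proof.
apply: measurable_prod => j _; case: (j < m)%N.
  apply: measurable_funB; first exact/measurable_indic/measurable_holds_beyond.
  apply: measurable_funM; first exact: measurable_cst.
  exact/measurable_indic/measurable_holds_beyond.
exact/measurable_indic/measurable_holds_beyond.
Qed.

Let integrable_F m t : P.-integrable (cylinder x0 s) (EFin \o F m t).
Proof.
apply: measurable_bounded_integrable.
- exact: measurable_cylinder.
- exact: le_lt_trans (probability_le1 _ (measurable_cylinder _ _)) (ltry _).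
- exact: measurable_funS (measurable_F m t).
exists 1; split; first exact: num_real.
move=> M M1 om _ /=; have /andP[F0 F1] := F01 m t om.
by rewrite ger0_norm// (le_trans F1)// ltW.
Qed.

(** Replacing one indicator by [g] turns the integral into a difference of two with other
    thresholds, so only the prescribed joint tails are ever integrated, and the result factorizes
    because they do. *)
Let integral_F m (t : nat -> R) : (m <= n.+1)%N -> (forall j, 0 <= t j) ->
  Rintegral P (cylinder x0 s) (F m t) =
  path_prob x0 s * \prod_(j < n.+1) (if (j < m)%N then q j else expR (- t j)).
Proof.
elim: m t => [|m IH] t mn t0.
  rewrite [in RHS](eq_bigr (fun j : 'I_n.+1 => expR (- t j)))//.
  pose A := [set om | forall j, (j <= size s)%N -> holds_beyond j (t j) om].
  have mA : measurable A.
    apply: measurable_forall => j; apply: measurable_imply.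
    exact: measurable_holds_beyond.
  have FE om : F 0%N t om = \1_A om.
    rewrite /F indicE (eq_bigr (fun j : 'I_n.+1 => \1_(holds_beyond j (t j)) om))//.
    have [h|h] := pselect (A om).
      rewrite (mem_set h) big1// => j _; rewrite indicE mem_set//.
      by apply: h; rewrite -ltnS.
    rewrite memNset//=; have [j] : exists j, ~ ((j <= size s)%N -> holds_beyond j (t j) om).
      by apply/existsNP.
    move=> /not_implyP[js hj]; have jn : (j < n.+1)%N by [].
    by rewrite (bigD1 (Ordinal jn))//= indicE memNset// mul0r.
  rewrite /Rintegral; under eq_integral do rewrite FE.
  rewrite integral_indic//; last exact: measurable_cylinder.
  exact: (congr1 fine (etrans (congr1 P (setIC _ _)) (cylinder_prob s t0))).
have upd0 u : 0 <= u -> forall j, 0 <= upd t m u j.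
  by move=> u0 j; rewrite /upd; case: ifP.
have FE om : F m.+1 t om = F m (upd t m 0) om - c m * F m (upd t m (e m)) om.
  exact: (@prod_upd R n.+1 m (fun j => g j om) t (fun j r => \1_(holds_beyond j r) om)).
rewrite (_ : Rintegral _ _ _ = Rintegral P (cylinder x0 s)
    (fun om => F m (upd t m 0) om - c m * F m (upd t m (e m)) om)); last first.
  by apply: eq_Rintegral => om _; exact: FE.
rewrite RintegralB//; last 2 first.
- exact: measurable_cylinder.
- have := @integrableZl _ _ _ P _ (measurable_cylinder x0 s) (c m) _ (integrable_F m (upd t m (e m))).
  by apply: eq_integrable => //; exact: measurable_cylinder.
rewrite RintegralZl//; last exact: measurable_cylinder.
rewrite !IH ?(ltnW mn)//; try exact: upd0.
rewrite (@prod_upd R n.+1 m q t (fun j r => expR (- r)) 0 (e m) (c m))//; last first.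
  by rewrite oppr0 expR0.
by ring.
Qed.

Lemma laplace_cylinder (l : R) :
  (P (cylinder x0 s `&` (holds_positive `&`
     [set om | (\sum_(j < (size s).+1) b j * E j om <= l)%R])) <=
   (expR l * (path_prob x0 s *
     \prod_(j < (size s).+1) (1 - (1 - expR (- (b j * e j))) * expR (- e j))))%:E)%E.
Proof.
set B := _ `&` [set om | _].
have mS : measurable_fun setT (fun om => \sum_(j < (size s).+1) b j * E j om).
  apply: measurable_sum => j; apply: measurable_funM; first exact: measurable_cst.
  exact: measurable_hold.
have mB : measurable B.
  apply: measurableI; first exact: measurable_holds_positive.
  have := mS measurableT _ (measurable_itv `]-oo, l]).
  rewrite setTI; congr measurable; apply/seteqP; split => om /=;
    by rewrite in_itv/=.
have := integral_F (leqnn n.+1) (fun j => lexx 0).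
under eq_bigr do rewrite ltn_ord.
have mc : measurable (cylinder x0 s) := measurable_cylinder x0 s.
move=> <-; rewrite -(@RintegralZl _ _ _ P _ _ (expR l) mc (integrable_F _ _)).
rewrite setIC -integral_indic//.
have iF : P.-integrable (cylinder x0 s) (EFin \o (fun om => expR l * F n.+1 (fun=> 0) om)).
  by apply: eq_integrable (integrableZl _ (expR l) (integrable_F n.+1 (fun=> 0))).
rewrite /Rintegral fineK; last exact: integrable_fin_num.
apply: ge0_le_integral => //.
- apply/measurable_EFinP; exact: measurable_indic.
- by case/integrableP: iF.
move=> om _; rewrite lee_fin indicE.
have [h|h] := boolP (om \in B); last first.
  by rewrite /= mulr_ge0 ?expR_ge0//; case/andP: (F01 n.+1 (fun=> 0) om).
move/set_mem: h => [hp hs] /=.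
rewrite /F; under eq_bigr do rewrite ltn_ord.
apply: (@le_trans _ _ (expR l * \prod_(j < n.+1) expR (- (b j * E j om)))).
  rewrite -expR_sum -expRD -expR0 ler_expR sumrN subr_ge0; exact: hs.
rewrite ler_wpM2l ?expR_ge0//; apply: ler_prod => j _; rewrite expR_ge0/=.
rewrite /g !indicE mem_set; last exact: hp.
have Ej : 0 < E j om := hp j.
have [h|h] := boolP (om \in _).
  move/set_mem: h => h; rewrite /c /= mulr1 opprB addrCA subrr addr0.
  by rewrite ler_expR lerN2 ler_wpM2l// ltW.
by rewrite /= mulr0 subr0 -expR0 ler_expR oppr_le0 mulr_ge0// ltW.
Qed.

End Laplace.

Lemma laplace_bound s (b : nat -> R) (l : R) : (forall j, 0 <= b j) ->
  0 <= path_prob x0 s ->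
  (P (cylinder x0 s `&` (holds_positive `&`
     [set om | (\sum_(j < (size s).+1) b j * E j om <= l)%R])) <=
   (expR l * (path_prob x0 s * \prod_(j < (size s).+1) hold_factor (b j)))%:E)%E.
Proof.
move=> b0 p0.
have /choice[e he] : forall j, exists u : R, 0 <= u /\
    1 - (1 - expR (- (b j * u))) * expR (- u) <= hold_factor (b j).
  by move=> j; have [u u0 hu] := two_valued_laplace (b0 j); exists u.
apply: (@le_trans _ _ _ _ _ (laplace_cylinder s b0 (fun j => (he j).1) l)).
rewrite lee_fin ler_wpM2l ?expR_ge0// ler_wpM2l//; apply: ler_prod => j _.
rewrite (he j).2 andbT subr_ge0 mulr_ile1 ?expR_ge0//.
- by rewrite subr_ge0 -expR0 ler_expR oppr_le0 mulr_ge0// (he j).1.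
- by rewrite -expR0 ler_expR oppr_le0 (he j).1.
Qed.

End Chain.

(** * Events of full probability and finite unions *)

Section FullProbability.
Context (d : measure_display) (T : measurableType d) (R : realType).
Variable P : probability T R.

Lemma prob_le (A B : set T) : measurable A -> measurable B -> A `<=` B ->
  (P A <= P B)%E.
Proof. by move=> mA mB AB; apply: le_measure => //; exact: mem_set. Qed.

Lemma prob_setU_le (A B : set T) : measurable A -> measurable B ->
  (P (A `|` B) <= P A + P B)%E.
Proof. by move=> mA mB; exact: measureU2. Qed.

Lemma measurable_le_cst (f : T -> R) l : measurable_fun setT f ->
  measurable [set om | f om <= l].
Proof.
move=> mf; have := mf measurableT _ (measurable_itv `]-oo, l]).
by rewrite setTI; congr measurable; apply/seteqP; split => om /=; rewrite in_itv.
Qed.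

Lemma measurable_cst_lt (f : T -> R) l : measurable_fun setT f ->
  measurable [set om | l < f om].
Proof.
move=> mf; have := mf measurableT _ (measurable_itv `]l, +oo[).
rewrite setTI; congr measurable; apply/seteqP; split => om /=;
  by rewrite in_itv/= andbT.
Qed.

Lemma prob1P (A : set T) : measurable A -> P A = 1%E <-> P (~` A) = 0%E.
Proof.
move=> mA; rewrite probability_setC//; split => [->|]; first by rewrite subee.
have : P A \is a fin_num by exact: fin_num_measure.
move: (P A) => [r| |]//= _ [] /eqP; rewrite subr_eq0 => /eqP h.
by congr EFin.
Qed.

Lemma prob_forall1 (F : nat -> set T) : (forall i, measurable (F i)) ->
  (forall i, P (F i) = 1%E) -> P [set om | forall i, F i om] = 1%E.
Proof.
move=> mF PF; apply/prob1P; first exact: measurable_forall.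
rewrite (_ : ~` _ = \bigcup_i ~` F i); last first.
  apply/seteqP; split => om /=; first by move/existsNP => [i h]; exists i.
  by move=> [i _ h] /(_ i).
apply/eqP; rewrite eq_le measure_ge0 andbT.
apply: le_trans (measure_sigma_subadditive _ _ _ (@subset_refl _ _)) _.
- by move=> i; exact: measurableC.
- by apply: bigcupT_measurable => i; exact: measurableC.
rewrite eseries0// => i _ _.
by apply/prob1P.
Qed.

Lemma prob_and1 (A B : set T) : measurable A -> measurable B ->
  P A = 1%E -> P B = 1%E -> P (A `&` B) = 1%E.
Proof.
move=> mA mB PA PB.
rewrite (_ : A `&` B = [set om | forall i : nat, (if i is 0%N then A else B) om]).
  by apply: prob_forall1 => -[|i].
apply/seteqP; split => [om [h1 h2] [|i]//|om h].
by split; [exact: (h 0%N)|exact: (h 1%N)].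
Qed.

Lemma prob_bigsetU_seq (I : eqType) (r : seq I) (F : I -> set T) : uniq r ->
  (forall i, measurable (F i)) ->
  (forall i j, i \in r -> j \in r -> i != j -> F i `&` F j = set0) ->
  P (\big[setU/set0]_(i <- r) F i) = (\sum_(i <- r) P (F i))%E.
Proof.
move=> + mF; elim: r => [|i r IH] /=; first by rewrite !big_nil measure0.
move=> /andP[ir ur] h; rewrite !big_cons measureU//.
- congr (_ + _)%E; apply: IH => // a b ar br.
  by apply: h; rewrite inE ?ar ?br ?orbT.
- exact: bigsetU_measurable.
have : forall a, a \in r -> F i `&` F a = set0.
  move=> a ar; apply: h; rewrite ?inE ?eqxx ?ar ?orbT//.
  by apply: contraNneq ir => ->.
elim: r {IH ir ur h} => [|a r IH] h; first by rewrite big_nil setI0.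
rewrite big_cons setIUr h ?inE ?eqxx// set0U IH// => b br.
by apply: h; rewrite inE br orbT.
Qed.

Lemma prob_bigsetU_le (I : eqType) (r : seq I) (F : I -> set T) :
  (forall i, measurable (F i)) ->
  (P (\big[setU/set0]_(i <- r) F i) <= \sum_(i <- r) P (F i))%E.
Proof.
move=> mF; elim: r => [|i r IH]; first by rewrite !big_nil measure0.
rewrite !big_cons; apply: le_trans (prob_setU_le _ _) _ => //.
  exact: bigsetU_measurable.
by rewrite leeD2l.
Qed.

End FullProbability.

(** * Sums over finite paths; almost sure properties of the holding times *)

Section Paths.
Variables (R : realType) (V : countType).
Variables (w : V -> V -> R) (mu : V -> R) (x0 : V).
Hypothesis graph_w : simple_weighted_graph w mu.

Fixpoint paths K x : seq (seq V) :=
  if K is K'.+1 then flatten [seq [seq y :: s | s <- paths K' y] | y <- nbhd w x]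
  else [:: [::]].

Lemma sum_paths K x (F : seq V -> R) :
  \sum_(s <- paths K.+1 x) F s = \sum_(y <- nbhd w x) \sum_(s <- paths K y) F (y :: s).
Proof.
rewrite /= big_flatten/= big_map; apply: eq_bigr => y _.
by rewrite big_map.
Qed.

Lemma size_paths K x s : s \in paths K x -> size s = K.
Proof.
elim: K x s => [|K IH] x s /=; first by rewrite inE => /eqP ->.
by move=> /flatten_mapP[y _ /mapP[s' /IH h ->]] /=; rewrite h.
Qed.

Lemma uniq_paths K x : uniq (paths K x).
Proof.
elim: K x => [|K IH] x //=.
elim: (enum_fset (nbhd w x)) (fset_uniq (nbhd w x)) => //= y r IHr /andP[yr ur].
rewrite cat_uniq IHr// andbT map_inj_uniq ?IH/=; last by move=> a b [].
apply/hasPn => s /flatten_mapP[z zr /mapP[s' _ ->]].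
apply/negP => /mapP[s'' _ [zy _]].
by move: yr; rewrite -zy zr.
Qed.

Lemma path_prob_ge0 x s : 0 <= path_prob w x s.
Proof. by elim: s x => //= y s IH x; rewrite mulr_ge0// (jump_prob_ge0 graph_w). Qed.

(** The expectation of a functional of the first [K] jumps from [x], a finite sum by local
    finiteness. *)
Definition path_mean K x (F : seq V -> R) : R :=
  \sum_(s <- paths K x) path_prob w x s * F s.

Lemma path_meanS K x F : path_mean K.+1 x F =
  \sum_(y <- nbhd w x) jump_prob w x y * path_mean K y (fun s => F (y :: s)).
Proof.
rewrite /path_mean sum_paths; apply: eq_bigr => y _.
by rewrite mulr_sumr; apply: eq_bigr => s _ /=; rewrite mulrA.
Qed.

Lemma path_mean0 x F : path_mean 0 x F = F [::].
Proof. by rewrite /path_mean big_seq1 mul1r. Qed.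

Lemma path_mean_cst K x c : path_mean K x (fun=> c) = c.
Proof.
elim: K x => [|K IH] x; first by rewrite path_mean0.
rewrite path_meanS; under eq_bigr do rewrite IH.
by rewrite -mulr_suml (sum_jump_prob graph_w) mul1r.
Qed.

Lemma path_meanZ K x c F : path_mean K x (fun s => c * F s) = c * path_mean K x F.
Proof. by rewrite /path_mean mulr_sumr; apply: eq_bigr => s _; rewrite mulrCA. Qed.

Lemma eq_path_mean K x F G : F =1 G -> path_mean K x F = path_mean K x G.
Proof. by move=> FG; apply: eq_bigr => s _; rewrite FG. Qed.

Context (d : measure_display) (Omega : measurableType d).
Variables (P : probability Omega R) (Y : nat -> Omega -> V) (E : nat -> Omega -> R).
Hypothesis chain : minimal_chain w mu x0 P Y E.

Let posK K : set Omega := [set om | forall j, (j <= K)%N -> holds_beyond E j 0 om].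

Let measurable_posK K : measurable (posK K).
Proof.
apply: measurable_forall => j; apply: measurable_imply.
exact: measurable_holds_beyond chain _ _.
Qed.

Let measurable_cyl_pos K s : measurable (cylinder Y x0 s `&` posK K).
Proof. apply: measurableI => //; exact: measurable_cylinder chain _ _. Qed.

(** The cylinders are disjoint and their prescribed probabilities sum to one. Hence, almost surely,
    the chain moves along edges and all holds are positive. *)
Let full_paths K :
  P (\big[setU/set0]_(s <- paths K x0) (cylinder Y x0 s `&` posK K)) = 1%E.
Proof.
rewrite prob_bigsetU_seq//; first last.
- move=> s s' sK s'K ss'; apply/seteqP; split => // om [[h1 _] [h2 _]].
  move/negP: ss'; apply; apply/eqP.
  have e : size s = size s' by rewrite (size_paths sK) (size_paths s'K).
  apply: (@eq_from_nth _ x0) => // i hi.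
  by rewrite -[LHS](h1 i.+1)// -[RHS](h2 i.+1)// -e.
- exact: uniq_paths.
rewrite -[RHS]/(1%:E) -(path_mean_cst K x0 1) /path_mean -sumEFin.
rewrite big_seq [RHS]big_seq; apply: eq_bigr => s sK; rewrite mulr1.
have := @cylinder_prob _ _ _ _ _ _ _ _ _ _ chain s (fun=> 0) (fun=> lexx 0).
rewrite big1; last by move=> i _; rewrite oppr0 expR0.
by rewrite mulr1 (size_paths sK).
Qed.

Lemma holds_positive_full : P (holds_positive E) = 1%E.
Proof.
rewrite (_ : holds_positive E = [set om | forall K, posK K om]); last first.
  apply/seteqP; split => om h; first by move=> K j _; exact: h.
  by move=> j; exact: (h j j).
apply: prob_forall1 => // K.
apply/eqP; rewrite eq_le probability_le1//=.
rewrite -(full_paths K); apply: prob_le => //; first exact: bigsetU_measurable.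
by rewrite -bigcup_seq => om [s _ []].
Qed.

(** Total probability over the first [K] jumps; the complement of the union of the cylinders over
    [paths K] is null. *)
Lemma prob_le_path_mean K (B : set Omega) (beta : seq V -> R) : measurable B ->
  (forall s, size s = K ->
    (P (cylinder Y x0 s `&` B) <= (path_prob w x0 s * beta s)%:E)%E) ->
  (P B <= (path_mean K x0 beta)%:E)%E.
Proof.
move=> mB hB.
pose G := \big[setU/set0]_(s <- paths K x0) (cylinder Y x0 s `&` posK K).
pose H := \big[setU/set0]_(s <- paths K x0) (cylinder Y x0 s `&` B).
have mcB s : measurable (cylinder Y x0 s `&` B).
  apply: measurableI => //; exact: measurable_cylinder chain _ _.
have mG : measurable G by exact: bigsetU_measurable.
have mH : measurable H by exact: bigsetU_measurable.
apply: (@le_trans _ _ (P (~` G `|` H))).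
  apply: prob_le => //; first by apply: measurableU => //; exact: measurableC.
  move=> om Bom; have [|nG] := pselect (G om); last by left.
  by rewrite /G -bigcup_seq => -[s sK [cs _]]; right; rewrite /H -bigcup_seq; exists s.
apply: le_trans (prob_setU_le _ _ _) _ => //; first exact: measurableC.
have -> : P (~` G) = 0%E by apply/prob1P => //; exact: full_paths.
rewrite add0e; apply: le_trans (prob_bigsetU_le _ _ _) _ => //.
rewrite /path_mean -sumEFin big_seq [leRHS]big_seq; apply: lee_sum => s sK.
by apply: hB; exact: size_paths sK.
Qed.

Lemma prob_sum_hold_le K (l : R) :
  (P (holds_positive E `&` [set om | (\sum_(j < K.+1) E j om <= l)%R]) <=
    (expR l * hold_factor (1 : R) ^+ K.+1)%:E)%E.
Proof.
have mS : measurable [set om | (\sum_(j < K.+1) E j om <= l)%R].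
  by apply: measurable_le_cst; apply: measurable_sum => j; exact: measurable_hold chain j.
rewrite -(path_mean_cst K x0 (expR l * hold_factor 1 ^+ K.+1)).
apply: prob_le_path_mean => [|s sK].
  by apply: measurableI => //; exact: measurable_holds_positive chain.
have := @laplace_bound _ _ _ _ _ _ _ _ _ _ chain s (fun=> 1) l (fun=> ler01) (path_prob_ge0 x0 s).
rewrite big_const_ord iter_mulr_1 sK [X in (_ <= X%:E)%E]mulrCA.
by under eq_set do under eq_bigr do rewrite mul1r.
Qed.

(** Exponential Chebyshev with all rates equal to 1: [hold_factor 1 < 1], so its powers beat the
    constant [exp(l)]. *)
Lemma sum_hold_diverges :
  P [set om | forall l : nat, exists K, (l%:R < \sum_(j < K.+1) E j om)%R] = 1%E.
Proof.
have mf K : measurable_fun setT (fun om => \sum_(j < K.+1) E j om).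
  by apply: measurable_sum => j; exact: measurable_hold chain j.
have mp := measurable_holds_positive chain.
have mS l K := measurable_le_cst l (mf K).
have mD (l : nat) : measurable [set om | exists K, (l%:R < \sum_(j < K.+1) E j om)%R].
  apply: (@measurable_exists _ _ (fun K => [set om | (l%:R < \sum_(j < K.+1) E j om)%R])) => K.
  exact: measurable_cst_lt.
apply: prob_forall1 => [l|l]; first exact: mD.
apply/prob1P; first exact: mD.
set A := ~` _.
have mA : measurable A := measurableC (mD l).
have : P (holds_positive E `&` A) = 0%E.
  apply/eqP; rewrite eq_le measure_ge0 andbT; apply/lee_addgt0Pr => e e0; rewrite add0e.
  have q0 := hold_factor_gt0 (@ler01 R).
  have q1 := hold_factor_lt1 (@ltr01 R).
  have [K _ hK] : \forall K \near \oo, expR l%:R * hold_factor (1 : R) ^+ K < e.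
    have : (expR l%:R * hold_factor (1 : R) ^+ K) @[K --> \oo] --> expR l%:R * 0.
      apply: cvgM; first exact: cvg_cst.
      by apply: cvg_expr; rewrite ger0_norm// ltW.
    by rewrite mulr0; move=> /(@cvgr_lt _ _ _ _ _); apply.
  apply: (@le_trans _ _ (P (holds_positive E `&` [set om | (\sum_(j < K.+1) E j om <= l%:R)%R]))).
    apply: prob_le; [exact: measurableI|exact: measurableI|].
    move=> om [h1 h2]; split => //=.
    by rewrite leNgt; apply/negP => h; apply: h2; exists K.
  apply: le_trans (prob_sum_hold_le _ _) _; rewrite lee_fin ltW//.
  by apply: hK; exact: leqnSn.
move=> PA; apply/eqP; rewrite eq_le measure_ge0 andbT.
apply: (@le_trans _ _ (P (~` holds_positive E `|` (holds_positive E `&` A)))).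
  apply: prob_le => //.
    by apply: measurableU; [exact: measurableC|exact: measurableI].
  by move=> om Aom; have [h|h] := pselect (holds_positive E om); [right|left].
apply: le_trans (prob_setU_le _ _ _) _.
- exact: measurableC.
- exact: measurableI.
rewrite PA adde0; have /prob1P -> // := holds_positive_full.
Qed.

End Paths.

Lemma big_ord_subitv (T : Type) (idx : T) (op : Monoid.com_law idx) n (g : nat -> T) i k :
  (i <= k <= n)%N ->
  \big[op/idx]_(j < n) (if (i <= j < k)%N then g j else idx) =
  \big[op/idx]_(i <= j < k) g j.
Proof.
move=> /andP[ik kn].
rewrite -(big_mkord xpredT (fun j => if (i <= j < k)%N then g j else idx)).
rewrite -big_mkcond/= (big_cat_nat (n := i))//=; last exact: leq_trans ik kn.
rewrite big_nat_cond big1 ?Monoid.mul1m; last first.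
  by move=> j /andP[/andP[_ ji] /andP[]]; rewrite leqNgt ji.
rewrite (big_cat_nat (n := k))//=.
rewrite [X in op _ X]big_nat_cond [X in op _ X]big1 ?Monoid.mulm1; last first.
  by move=> j /andP[/andP[kj _] /andP[_]]; rewrite ltnNge kj.
by rewrite big_nat_cond [RHS]big_nat_cond; apply: eq_bigl => j; rewrite andbb andbT.
Qed.

(** * Functions of a random variable with countably many values *)

Section DiscreteMeasurability.
Context (d : measure_display) (T : measurableType d) (W : countType).
Variable Z : T -> W.
Hypothesis mZ : forall z, measurable [set om | Z om = z].

Lemma measurable_discrete (A : set W) : measurable [set om | A (Z om)].
Proof.
rewrite (_ : [set om | _] =
    [set om | exists n : nat,
      [set om | exists2 z : W, choice.unpickle n = Some z & A z /\ Z om = z] om]).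
  apply: measurable_exists => n; case E: (choice.unpickle n : option W) => [z|]; last first.
    rewrite (_ : [set om | _] = set0); first exact: measurable0.
    by apply/seteqP; split => om //= -[z].
  have [Az|nAz] := pselect (A z).
    rewrite (_ : [set om | _] = [set om | Z om = z]); first exact: mZ.
    by apply/seteqP; split => [om [z' [<-] []]//|om /= Zz]; exists z.
  rewrite (_ : [set om | _] = set0); first exact: measurable0.
  by apply/seteqP; split => om //= -[z' [<-] []].
apply/seteqP; split => [om Az|om [n [z _ [Az e]]]]; last by rewrite /= e.
by exists (choice.pickle (Z om)), (Z om); rewrite ?choice.pickleK.
Qed.

Lemma measurable_fun_discrete (R : realType) (f : W -> R) :
  measurable_fun setT (fun om => f (Z om)).
Proof.
move=> _ A mA; rewrite setTI.
exact: (measurable_discrete [set z | A (f z)]).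
Qed.

End DiscreteMeasurability.

(** * Crossing events and the weights of their paths *)

Section Crossing.
Variables (R : realType) (V : countType).
Variables (w : V -> V -> R) (mu : V -> R) (sigma : V -> V -> R) (x0 : V).
Hypothesis graph_w : simple_weighted_graph w mu.
Variables (B1 B2 : pred V) (theta b l : R).
Hypothesis b_ge0 : 0 <= b.

Definition exits_at (B : pred V) (y : nat -> V) i : Prop :=
  (forall j, (j < i)%N -> B (y j)) /\ ~~ B (y i).

Lemma exits_at_uniq B y i j : exits_at B y i -> exits_at B y j -> i = j.
Proof.
move=> [hi ni] [hj nj]; case: (ltngtP i j) => // ij.
  by rewrite (hj _ ij) in ni.
by rewrite (hi _ ij) in nj.
Qed.

(** Bound for one step of the exponential moment of minus the cost: [sigma] is known along a path,
    the hold contributes [hold_factor]. The sign of [theta] is free, and the supermartingale case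
    takes [theta = -1]. *)
Definition cross_kernel x y : R :=
  expR (- (theta * sigma x y ^+ 2)) * hold_factor (b * mean_hold w mu x).

(** The value 0 on a path that ends inside [B2] means that only crossings completed within the
    horizon are counted; the others are recovered by letting the horizon grow. *)
Fixpoint inner_weight x (s : seq V) : R :=
  if B2 x then (if s is y :: s' then cross_kernel x y * inner_weight y s' else 0)
  else 1.

Fixpoint outer_weight x (s : seq V) : R :=
  if B1 x then (if s is y :: s' then outer_weight y s' else 0)
  else inner_weight x s.

Lemma inner_weight_prod x s k : (k <= size s)%N ->
  exits_at B2 (nth x0 (x :: s)) k ->
  inner_weight x s = \prod_(0 <= j < k)
    cross_kernel (nth x0 (x :: s) j) (nth x0 (x :: s) j.+1).
Proof.
elim: s x k => [|y s IH] x [|k] //= ks [h n].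
- by rewrite (negbTE n) big_geq.
- by rewrite (negbTE n) big_geq.
rewrite (h 0%N)// big_nat_recl//=; congr (_ * _); apply: IH => //.
by split => [j jk|//]; exact: (h j.+1).
Qed.

Lemma outer_weight_prod x s i k : (i <= k <= size s)%N ->
  exits_at B1 (nth x0 (x :: s)) i -> exits_at B2 (nth x0 (x :: s)) k ->
  outer_weight x s = \prod_(i <= j < k)
    cross_kernel (nth x0 (x :: s) j) (nth x0 (x :: s) j.+1).
Proof.
move=> /andP[]; elim: s x i k => [|y s IH] x [|i] [|k] //= ik ks [h1 n1] [h2 n2].
- by rewrite (negbTE n1) (negbTE n2) big_geq.
- by rewrite (negbTE n1) (negbTE n2) big_geq.
- by rewrite (negbTE n1) -(@inner_weight_prod x (y :: s) k.+1).
rewrite (h1 0%N)// big_add1/=; apply: IH => //.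
  by split => [j jk|//]; exact: (h1 j.+1).
by split => [j jk|//]; exact: (h2 j.+1).
Qed.

Lemma cross_kernel_ge0 x y : 0 <= cross_kernel x y.
Proof.
rewrite mulr_ge0 ?expR_ge0// ltW// hold_factor_gt0// mulr_ge0//.
exact/ltW/(mean_hold_gt0 graph_w).
Qed.

Lemma inner_weight_ge0 x s : 0 <= inner_weight x s.
Proof.
elim: s x => [|y s IH] x /=; case: (B2 x) => //.
by rewrite mulr_ge0// cross_kernel_ge0.
Qed.

Lemma outer_weight_ge0 x s : 0 <= outer_weight x s.
Proof.
elim: s x => [|y s IH] x /=; first by case: (B1 x) => //; exact: (inner_weight_ge0 x [::]).
by case: (B1 x) => //; exact: (inner_weight_ge0 x (y :: s)).
Qed.

Definition inner_mean K x := path_mean w K x (inner_weight x).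
Definition outer_mean K x := path_mean w K x (outer_weight x).

Lemma inner_mean0 x : inner_mean 0 x = (~~ B2 x)%:R.
Proof. by rewrite /inner_mean path_mean0/=; case: (B2 x). Qed.

Lemma inner_meanS K x : inner_mean K.+1 x =
  if B2 x then \sum_(y <- nbhd w x) jump_prob w x y * (cross_kernel x y * inner_mean K y)
  else 1.
Proof.
rewrite /inner_mean; case: ifPn => h; last first.
  rewrite -(path_mean_cst graph_w K.+1 x 1); apply: eq_path_mean => s.
  by case: s => [|y s] /=; rewrite (negbTE h).
rewrite path_meanS; apply: eq_bigr => y _.
by congr (_ * _); rewrite -path_meanZ; apply: eq_path_mean => s /=; rewrite h.
Qed.

(** The Markov property at the exit from [B1], by induction on the horizon: the exit point is the
    start or a neighbor of a vertex of [B1]. All horizons occur in the hypothesis because the one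
    remaining after the exit varies. *)
Lemma outer_mean_le (delta : R) K x : 0 <= delta ->
  (forall K y, ~~ B1 y -> y = x \/ (exists2 z, B1 z & 0 < w z y) ->
    inner_mean K y <= delta) ->
  outer_mean K x <= delta.
Proof.
move=> d0; elim: K x => [|K IH] x h.
  rewrite /outer_mean path_mean0/=; case: ifPn => // nB.
  by have := h 0%N x nB (or_introl erefl); rewrite /inner_mean path_mean0.
rewrite /outer_mean; have [Bx|nB] := boolP (B1 x); last first.
  rewrite (@eq_path_mean _ _ _ _ _ _ (inner_weight x)); last first.
    by move=> s; case: s => [|y s] /=; rewrite (negbTE nB).
  by apply: h => //; left.
rewrite path_meanS -[leRHS]mul1r -(sum_jump_prob graph_w x) mulr_suml.
rewrite big_seq [leRHS]big_seq; apply: ler_sum => y yx.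
rewrite ler_wpM2l ?(jump_prob_ge0 graph_w)//.
rewrite (@eq_path_mean _ _ _ _ _ _ (outer_weight y)); last by move=> s /=; rewrite Bx.
apply: IH => K' z nz [zy|hz]; last by apply: h => //; right.
apply: h => //; right; exists x => //.
by rewrite zy -(mem_nbhd graph_w).
Qed.

Context (d : measure_display) (Omega : measurableType d).
Variables (P : probability Omega R) (Y : nat -> Omega -> V) (E : nat -> Omega -> R).
Hypothesis chain : minimal_chain w mu x0 P Y E.

Definition cost i k om : R := \sum_(i <= j < k)
  (theta * sigma (Y j om) (Y j.+1 om) ^+ 2 + b * mean_hold w mu (Y j om) * E j om).

Definition crossing : set Omega := [set om | exists i, exists k,
  (i <= k)%N /\ (exits_at B1 (Y^~ om) i /\ (exits_at B2 (Y^~ om) k /\ cost i k om <= l))].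

Let crossingK K : set Omega := [set om | exists i, exists k,
  (i <= k <= K)%N /\ (exits_at B1 (Y^~ om) i /\ (exits_at B2 (Y^~ om) k /\ cost i k om <= l))].

Lemma measurable_exits_at B i : measurable [set om | exits_at B (Y^~ om) i].
Proof.
have mY j (A : set V) : measurable [set om | A (Y j om)].
  by apply: measurable_discrete => y; exact: measurable_pos_at chain j y.
apply: (@measurable_and _ _ [set om | forall j, (j < i)%N -> B (Y j om)]).
  apply: (@measurable_forall _ _ (fun j => [set om | (j < i)%N -> B (Y j om)])) => j.
  by apply: (@measurable_imply _ _ _ [set om | B (Y j om)]); exact: (mY j B).
exact: (mY i [set y | ~~ B y]).
Qed.

Lemma measurable_fun_cost i k : measurable_fun setT (cost i k).
Proof.
have mY j y := measurable_pos_at chain j y.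
apply: measurable_sum => j; apply: measurable_funD; apply: measurable_funM.
- exact: measurable_cst.
- apply: (@measurable_fun_discrete _ _ (V * V)%type (fun om => (Y j om, Y j.+1 om)) _
    R (fun z => sigma z.1 z.2 ^+ 2)) => -[y z].
  rewrite (_ : mkset _ = [set om | Y j om = y] `&` [set om | Y j.+1 om = z]).
    exact: measurableI.
  by apply/seteqP; split => om /= [-> ->].
- by apply: (measurable_fun_discrete (mY j) (fun z => b * mean_hold w mu z)).
- exact: measurable_hold chain j.
Qed.

Let measurable_crossing_aux (p : nat -> nat -> bool) :
  measurable [set om | exists i, exists k, p i k /\
    (exits_at B1 (Y^~ om) i /\ (exits_at B2 (Y^~ om) k /\ cost i k om <= l))].
Proof.
apply: (@measurable_exists _ _ (fun i => [set om | exists k, p i k /\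
    (exits_at B1 (Y^~ om) i /\ (exits_at B2 (Y^~ om) k /\ cost i k om <= l))])) => i.
apply: (@measurable_exists _ _ (fun k => [set om | p i k /\
    (exits_at B1 (Y^~ om) i /\ (exits_at B2 (Y^~ om) k /\ cost i k om <= l))])) => k.
have [pik|npik] := boolP (p i k); last first.
  by rewrite (_ : mkset _ = set0)//; apply/seteqP; split => om //= -[].
rewrite (_ : mkset _ = [set om | exits_at B1 (Y^~ om) i] `&`
    ([set om | exits_at B2 (Y^~ om) k] `&` [set om | cost i k om <= l])).
  apply: measurableI; first exact: measurable_exits_at.
  apply: measurableI; first exact: measurable_exits_at.
  exact/measurable_le_cst/measurable_fun_cost.
by apply/seteqP; split => [om [_ []]//|om [h1 [h2 h3]]].
Qed.

Lemma measurable_crossing : measurable crossing.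
Proof. exact: (measurable_crossing_aux (fun i k => i <= k)%N). Qed.

Let prob_crossingK K :
  (P (holds_positive E `&` crossingK K) <= (expR l * outer_mean K x0)%:E)%E.
Proof.
rewrite /outer_mean -path_meanZ; apply: (prob_le_path_mean graph_w chain).
  apply: measurableI; first exact: measurable_holds_positive chain.
  exact: (measurable_crossing_aux (fun i k => i <= k <= K)%N).
move=> s sK; pose y := nth x0 (x0 :: s).
have [[i [k [ikK [e1 e2]]]]|no] := pselect (exists i, exists k,
    (i <= k <= K)%N /\ (exits_at B1 y i /\ exits_at B2 y k)); last first.
  rewrite (_ : _ `&` _ = set0).
    rewrite measure0 lee_fin mulr_ge0 ?(path_prob_ge0 graph_w)//.
    by rewrite mulr_ge0 ?expR_ge0 ?outer_weight_ge0.
  apply/seteqP; split => // om [cyl [_ [i [k [ikK [h1 [h2 _]]]]]]]; apply: no.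
  have /andP[ik kK] := ikK.
  exists i, k; split => //.
  have ex B j : (j <= K)%N -> exits_at B (Y^~ om) j -> exits_at B y j.
    move=> jK [hB nB]; split => [j' j'j|].
      by rewrite /y -cyl ?hB// sK (leq_trans (ltnW j'j)).
    by rewrite /y -cyl// sK.
  by split; apply: ex => //; exact: leq_trans kK.
have /andP[ik kK] := ikK.
rewrite (outer_weight_prod (i := i) (k := k))//; last by rewrite ik sK.
(* Rates vanish outside the window, where [hold_factor 0 = 1], so the bound for the whole path
   applies to a segment of it. The [sigma] part of the cost is constant on the cylinder and moves
   into the threshold as [S]. *)
pose bb j : R := if (i <= j < k)%N then b * mean_hold w mu (y j) else 0.
have bb0 j : 0 <= bb j.
  rewrite /bb; case: ifP => // _; rewrite mulr_ge0//.
  exact/ltW/(mean_hold_gt0 graph_w).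
pose S := \sum_(i <= j < k) theta * sigma (y j) (y j.+1) ^+ 2.
have := @laplace_bound _ _ _ _ _ _ _ _ _ _ chain s bb (l - S) bb0 (path_prob_ge0 graph_w x0 s).
have -> : expR (l - S) * (path_prob w x0 s * \prod_(j < (size s).+1) hold_factor (bb j)) =
    path_prob w x0 s * (expR l * \prod_(i <= j < k) cross_kernel (y j) (y j.+1)).
  rewrite mulrCA; congr (_ * _); rewrite expRD -mulrA; congr (_ * _).
  rewrite sK -sumrN expR_sum.
  rewrite (eq_bigr (fun j : 'I_K.+1 => if (i <= j < k)%N then
      hold_factor (b * mean_hold w mu (y j)) else 1)); last first.
    by move=> j _; rewrite /bb; case: ifP => // _; rewrite hold_factor0.
  rewrite (big_ord_subitv _ (fun j => hold_factor (b * mean_hold w mu (y j)))) ?ik ?leqW//.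
  by rewrite -big_split/=; apply: eq_bigr.
apply: le_trans; apply: prob_le.
- apply: measurableI; first exact: measurable_cylinder chain _ _.
  apply: measurableI; first exact: measurable_holds_positive chain.
  exact: (measurable_crossing_aux (fun i k => i <= k <= K)%N).
- apply: measurableI; first exact: measurable_cylinder chain _ _.
  apply: measurableI; first exact: measurable_holds_positive chain.
  apply: measurable_le_cst; apply: measurable_sum => j.
  apply: measurable_funM; [exact: measurable_cst|exact: measurable_hold chain j].
move=> om [cyl [pos [i' [k' [ikK' [h1 [h2 hc]]]]]]]; split => //; split => //=.
have /andP[ik' kK'] := ikK'.
have ex B j : (j <= K)%N -> exits_at B (Y^~ om) j -> exits_at B y j.
  move=> jK [hB nB]; split => [j' j'j|].
    by rewrite /y -cyl ?hB// sK (leq_trans (ltnW j'j)).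
  by rewrite /y -cyl// sK.
have ei : i' = i by apply: exits_at_uniq e1; apply: ex => //; exact: leq_trans kK'.
have ek : k' = k by apply: exits_at_uniq e2; exact: ex.
move: hc; rewrite ei ek /cost big_split/= lerBrDl sK => hc.
rewrite (eq_bigr (fun j : 'I_K.+1 => if (i <= j < k)%N then
      b * mean_hold w mu (y j) * E j om else 0)); last first.
  by move=> j _; rewrite /bb; case: ifP => // _; rewrite mul0r.
rewrite (big_ord_subitv _ (fun j => b * mean_hold w mu (y j) * E j om)) ?ik ?leqW//.
apply: le_trans hc; rewrite le_eqVlt; apply/orP; left; apply/eqP.
have yE j : (j <= k)%N -> Y j om = y j.
  by move=> jk; rewrite /y -cyl// sK (leq_trans jk).
rewrite /S; congr (_ + _); apply: eq_big_nat => j /andP[ij jk];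
  by rewrite !yE// ltnW.
Qed.

(** Crossings completed within [K] jumps increase to all crossings, and their bound is independent
    of [K]. *)
Lemma prob_crossing (delta : R) : 0 <= delta ->
  (forall K y, ~~ B1 y -> y = x0 \/ (exists2 z, B1 z & 0 < w z y) ->
    inner_mean K y <= delta) ->
  (P crossing <= (expR l * delta)%:E)%E.
Proof.
move=> d0 hd.
have mp := measurable_holds_positive chain.
have mK K : measurable (holds_positive E `&` crossingK K).
  apply: measurableI => //; exact: (measurable_crossing_aux (fun i k => i <= k <= K)%N).
have PK K : (P (holds_positive E `&` crossingK K) <= (expR l * delta)%:E)%E.
  apply: le_trans (prob_crossingK K) _.
  by rewrite lee_fin ler_wpM2l ?expR_ge0// outer_mean_le.
have cv : P (holds_positive E `&` crossingK K) @[K --> \oo] -->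
    P (\bigcup_K (holds_positive E `&` crossingK K)).
  apply: nondecreasing_cvg_mu => //; first exact: bigcupT_measurable.
  apply/nondecreasing_seqP => K; apply/subsetPset => om [hp [i [k [/andP[ik kK] h]]]].
  by split => //; exists i, k; split => //; rewrite ik leqW.
have le1 : (P (\bigcup_K (holds_positive E `&` crossingK K)) <= (expR l * delta)%:E)%E.
  rewrite -(cvg_lim _ cv)//; apply: lime_le; first by apply/cvg_ex; eexists; exact: cv.
  exact: nearW.
apply: (@le_trans _ _ (P (~` holds_positive E `|`
    \bigcup_K (holds_positive E `&` crossingK K)))).
  apply: prob_le; first exact: measurable_crossing.
    by apply: measurableU; [exact: measurableC|exact: bigcupT_measurable].
  move=> om [i [k [ik h]]]; have [hp|hp] := pselect (holds_positive E om); last by left.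
  by right; exists k => //; split => //; exists i, k; rewrite ik leqnn.
apply: le_trans (prob_setU_le _ _ _) _.
- exact: measurableC.
- exact: bigcupT_measurable.
have /prob1P -> // := holds_positive_full graph_w chain.
by rewrite add0e.
Qed.

End Crossing.

(** Jensen for the square root, read off from the nonnegativity of a variance. *)
Lemma sum_sqrt_le (R : realType) (I : eqType) (r : seq I) (p z : I -> R) :
  (forall i, 0 <= p i) -> (forall i, 0 <= z i) -> \sum_(i <- r) p i = 1 ->
  \sum_(i <- r) p i * Num.sqrt (z i) <= Num.sqrt (\sum_(i <- r) p i * z i).
Proof.
move=> p0 z0 p1; set m := leLHS.
have m0 : 0 <= m by apply: sumr_ge0 => i _; rewrite mulr_ge0 ?sqrtr_ge0.
rewrite -[leLHS]ger0_norm// -sqrtr_sqr ler_wsqrtr//.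
have : 0 <= \sum_(i <- r) p i * (Num.sqrt (z i) - m) ^+ 2.
  by apply: sumr_ge0 => i _; rewrite mulr_ge0 ?sqr_ge0.
rewrite (eq_bigr (fun i => p i * z i - 2 * m * (p i * Num.sqrt (z i)) + m ^+ 2 * p i)).
  rewrite big_split/= sumrB -!mulr_sumr p1 -/m mulr1.
  by rewrite (_ : 2 * m * m = m ^+ 2 + m ^+ 2); [lra|ring].
by move=> i _; rewrite -{2}(sqr_sqrtr (z0 i)); ring.
Qed.

(** * The supermartingale estimate and the annulus estimate *)

Section CrossingEstimates.
Variables (R : realType) (V : countType).
Variables (w : V -> V -> R) (mu : V -> R) (sigma : V -> V -> R) (xbar : V).
Hypothesis graph_w : simple_weighted_graph w mu.
Hypothesis adapted_sigma : adapted_weight w mu sigma.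
Local Notation D := (adapted_dist w sigma xbar).
Local Notation h := (mean_hold w mu).
Local Notation kappa := (@expR R 1).

Definition slow_rate : R := (2 * kappa + kappa ^+ 2) / hold_rate R.

Lemma slow_rate_gt0 : 0 < slow_rate.
Proof.
rewrite divr_gt0 ?hold_rate_gt0// addr_gt0 ?mulr_gt0 ?exprn_gt0 ?expR_gt0//.
Qed.

(** Let [A] be the mean of [exp(sigma^2)] over a jump. Since [exp z <= 1 + e z] on [[0, 1]],
    [A <= 1 + e h]; also [A <= e]. The first bound serves [h <= 1], the second [h > 1], and
    [slow_rate] is such that the claim reads [A^2 <= 1 + (2 e + e^2) h]. *)
Lemma slow_kernel_le1 x :
  \sum_(y <- nbhd w x) jump_prob w x y * cross_kernel w mu sigma (-1) slow_rate x y <= 1.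
Proof.
have h0 := mean_hold_gt0 graph_w x.
have r0 := hold_rate_gt0 R.
have k0 : 0 < kappa := expR_gt0 1.
have k2 : 0 < kappa ^+ 2 by rewrite exprn_gt0.
rewrite /cross_kernel; under eq_bigr do rewrite mulrA.
rewrite -mulr_suml /hold_factor.
have -> : hold_rate R * (slow_rate * h x) = (2 * kappa + kappa ^+ 2) * h x.
  by rewrite /slow_rate; field; rewrite gt_eqF.
have pos : 0 < 1 + (2 * kappa + kappa ^+ 2) * h x.
  by rewrite addr_gt0// mulr_gt0// addr_gt0// mulr_gt0.
rewrite ler_pdivrMr ?sqrtr_gt0// mul1r.
set A := leLHS.
have A0 : 0 <= A.
  by apply: sumr_ge0 => y _; rewrite mulr_ge0 ?expR_ge0 ?(jump_prob_ge0 graph_w).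
have sg01 y : y \in nbhd w x -> 0 <= sigma x y ^+ 2 <= 1.
  rewrite (mem_nbhd graph_w) => xy; rewrite sqr_ge0 expr_le1//.
    exact: (sigma_le1 adapted_sigma).
  exact/ltW/(sigma_gt0 adapted_sigma).
have A1 : A <= 1 + kappa * h x.
  apply: (@le_trans _ _ (\sum_(y <- nbhd w x)
      (jump_prob w x y + kappa * (jump_prob w x y * sigma x y ^+ 2)))).
    rewrite /A big_seq [leRHS]big_seq; apply: ler_sum => y yx.
    rewrite mulN1r opprK mulrCA -{2}[jump_prob w x y]mulr1 -mulrDr.
    by rewrite ler_wpM2l ?(jump_prob_ge0 graph_w)// expR_le1D// sg01.
  rewrite big_split/= (sum_jump_prob graph_w) -mulr_sumr lerD2l ler_pM2l//.
  exact: sum_jump_prob_sigma2_le.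
have A2 : A <= kappa.
  apply: (@le_trans _ _ (\sum_(y <- nbhd w x) jump_prob w x y * kappa)); last first.
    by rewrite -mulr_suml (sum_jump_prob graph_w) mul1r.
  rewrite /A big_seq [leRHS]big_seq; apply: ler_sum => y yx.
  rewrite ler_wpM2l ?(jump_prob_ge0 graph_w)// mulN1r opprK ler_expR.
  by have /andP[] := sg01 _ yx.
rewrite -[A]ger0_norm// -sqrtr_sqr ler_wsqrtr//.
have [h1|h1] := leP (h x) 1.
  apply: (@le_trans _ _ ((1 + kappa * h x) ^+ 2)).
    by rewrite ler_sqr ?nnegrE//; apply: le_trans A1.
  have -> : (1 + kappa * h x) ^+ 2 = 1 + 2 * kappa * h x + kappa ^+ 2 * (h x * h x).
    by ring.
  have : kappa ^+ 2 * (h x * h x) <= kappa ^+ 2 * h x.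
    by rewrite ler_pM2l// ger_pMl.
  by lra.
apply: (@le_trans _ _ (kappa ^+ 2)).
  by rewrite ler_sqr ?nnegrE// ltW.
have : kappa ^+ 2 * 1 <= kappa ^+ 2 * h x by rewrite ler_pM2l// ltW.
have : 0 < kappa * h x by rewrite mulr_gt0.
by lra.
Qed.

Lemma slow_inner_mean_le1 (B2 : pred V) K x :
  inner_mean w mu sigma B2 (-1) slow_rate K x <= 1.
Proof.
elim: K x => [|K IH] x; first by rewrite inner_mean0; case: (B2 x) => /=.
rewrite (inner_meanS _ graph_w); case: ifP => // _.
apply: le_trans (slow_kernel_le1 x); apply: ler_sum => y _.
rewrite ler_wpM2l ?(jump_prob_ge0 graph_w)//.
by rewrite ler_piMr// (cross_kernel_ge0 _ graph_w)// ltW// slow_rate_gt0.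
Qed.

Section Annulus.
Variables (c0 rho q M s : R).
Hypothesis c0_gt0 : 0 < c0.
Hypothesis c0_le : forall x, c0 <= mu x.
Hypothesis fin_ball : finite_set (ball_d (adapted_dist w sigma) xbar (rho + 1)).
Hypothesis vol_le :
  \sum_(x <- fset_set (ball_d (adapted_dist w sigma) xbar (rho + 1))) mu x <= expR M.
Hypothesis M_ge1 : 1 <= M.
Hypothesis q_gt0 : 0 < q.
Hypothesis s_gt0 : 0 < s.
Hypothesis sq_eq : s * q = 8 * M.
Let B2 : pred V := fun x => D x <= rho.
(** Here [p f = w exp(-(s sigma)^2) / (wdeg + 2 e s^2 mu)]: clearing the denominator leaves
    symmetric weights and a killing term. *)
Let f x y := expR (- (s * sigma x y) ^+ 2) / (1 + 2 * kappa * s ^+ 2 * h x).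

(** Chosen so that [hold_factor (fast_rate * h)] is the inverse root of the denominator of [f]; with
    [theta = s^2 / 2] the crossing kernel is then [sqrt f]. *)
Definition fast_rate : R := 2 * kappa * s ^+ 2 / hold_rate R.

Let den_gt0 x : 0 < 1 + 2 * kappa * s ^+ 2 * h x.
Proof.
have := mean_hold_gt0 graph_w x => hx.
by rewrite addr_gt0// mulr_gt0// mulr_gt0 ?exprn_gt0// mulr_gt0 ?expR_gt0.
Qed.

Let f_ge0 x y : 0 <= f x y.
Proof. by rewrite /f divr_ge0 ?expR_ge0// ltW// den_gt0. Qed.

Let f_le1 x y : f x y <= 1.
Proof.
rewrite /f ler_pdivrMr ?den_gt0// mul1r; apply: (@le_trans _ _ 1).
  by rewrite -[leRHS]expR0 ler_expR oppr_le0 sqr_ge0.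
have := mean_hold_gt0 graph_w x => hx.
by rewrite lerDl ltW// mulr_gt0// mulr_gt0 ?exprn_gt0// mulr_gt0 ?expR_gt0.
Qed.

Fixpoint damped_exit K x : R :=
  if B2 x then (if K is K'.+1 then
    \sum_(y <- nbhd w x) jump_prob w x y * (f x y * damped_exit K' y) else 0) else 1.

Local Notation v := damped_exit.

Let v01 K x : 0 <= v K x <= 1.
Proof.
elim: K x => [|K IH] x /=; case: (B2 x); rewrite ?lexx ?ler01//.
apply/andP; split.
  apply: sumr_ge0 => y _; have /andP[v0 _] := IH y.
  by apply: mulr_ge0; [exact: (jump_prob_ge0 graph_w)|exact: mulr_ge0].
rewrite -(sum_jump_prob graph_w x); apply: ler_sum => y _.
have /andP[v0 v1] := IH y.
by rewrite ler_piMr ?(jump_prob_ge0 graph_w)// mulr_ile1.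
Qed.

(** A longer horizon only adds exits. Since [v K.+1] averages [v K], this makes every truncation a
    subsolution, and no limit in [K] is taken. *)
Let v_incr K x : v K x <= v K.+1 x.
Proof.
elim: K x => [|K IH] x.
  rewrite /=; case: (B2 x) => //; apply: sumr_ge0 => y _.
  apply: mulr_ge0; first exact: (jump_prob_ge0 graph_w).
  by apply: mulr_ge0 => //; case: (B2 y).
rewrite [leLHS]/= [leRHS]/=; case: (B2 x) => //; apply: ler_sum => y _.
by rewrite ler_wpM2l ?(jump_prob_ge0 graph_w)// ler_wpM2l//; exact: IH.
Qed.

Let v_sub K x : D x <= rho ->
  v K x * (wdeg w x + 2 * kappa * s ^+ 2 * mu x) <=
  \sum_(y <- nbhd w x) w x y * expR (- (s * sigma x y) ^+ 2) * v K y.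
Proof.
move=> xr; have dg := wdeg_gt0 graph_w x; have dn := den_gt0 x.
have pos : 0 < wdeg w x + 2 * kappa * s ^+ 2 * mu x.
  have := mass_gt0 graph_w x => mx.
  by rewrite addr_gt0// mulr_gt0// mulr_gt0 ?exprn_gt0// mulr_gt0 ?expR_gt0.
rewrite -ler_pdivlMr//; apply: le_trans (v_incr K x) _ => /=.
rewrite {1}/B2 xr mulr_suml le_eqVlt; apply/orP; left; apply/eqP.
apply: eq_bigr => y _; rewrite /jump_prob /f /mean_hold; field.
by rewrite !gt_eqF.
Qed.

Let sqrt_f x y : cross_kernel w mu sigma (s ^+ 2 / 2) fast_rate x y = Num.sqrt (f x y).
Proof.
rewrite /cross_kernel /f /hold_factor /fast_rate.
have r0 := hold_rate_gt0 R.
have -> : hold_rate R * (2 * kappa * s ^+ 2 / hold_rate R * h x) = 2 * kappa * s ^+ 2 * h x.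
  by field; rewrite gt_eqF.
rewrite sqrtrM ?expR_ge0// sqrtrV ?(ltW (den_gt0 x))//; congr (_ * _).
have -> : - (s * sigma x y) ^+ 2 =
    - (s ^+ 2 / 2 * sigma x y ^+ 2) + - (s ^+ 2 / 2 * sigma x y ^+ 2) by field.
by rewrite expRD -expr2 sqrtr_sqr ger0_norm// expR_ge0.
Qed.

Let inner_mean_le_sqrt K x :
  inner_mean w mu sigma B2 (s ^+ 2 / 2) fast_rate K x <= Num.sqrt (v K x).
Proof.
elim: K x => [|K IH] x.
  by rewrite inner_mean0/=; case: (B2 x); rewrite ?sqrtr0 ?sqrtr1.
rewrite (inner_meanS _ graph_w) /=; case: (B2 x); last by rewrite sqrtr1.
apply: le_trans (sum_sqrt_le _ _ (sum_jump_prob graph_w x)).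
- apply: ler_sum => y _; rewrite ler_wpM2l ?(jump_prob_ge0 graph_w)//.
  by rewrite sqrtrM// sqrt_f ler_wpM2l ?sqrtr_ge0//; exact: IH.
- by move=> y; exact: (jump_prob_ge0 graph_w).
- by move=> y; have /andP[v0 _] := v01 K y; rewrite mulr_ge0.
Qed.

Definition annulus_const : R := Num.sqrt (2 / Num.sqrt c0).

Lemma annulus_inner_mean K y : D y <= rho - q ->
  inner_mean w mu sigma (fun x => D x <= rho) (s ^+ 2 / 2) fast_rate K y <=
  annulus_const * expR (- (3 * M)).
Proof.
move=> yr; have q0 := q_gt0; have M1 := M_ge1.
apply: le_trans (inner_mean_le_sqrt K y) _.
have sc0 : 0 < Num.sqrt c0 by rewrite sqrtr_gt0.
have -> : annulus_const * expR (- (3 * M)) =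
    Num.sqrt (2 / Num.sqrt c0 * (expR (- (3 * M))) ^+ 2).
  by rewrite sqrtrM ?divr_ge0 ?ltW// sqrtr_sqr ger0_norm// expR_ge0.
apply: ler_wsqrtr.
have yr' : D y <= rho by lra.
have := pointwise_l2_bound graph_w adapted_sigma s_gt0 (v01 K) (v_sub K) fin_ball yr'.
set ph := expR (s * (rho - D y)) - 1 => hl2.
have /andP[v0 _] := v01 K y.
(* On the inner ball [s (rho - D y) >= s q = 8 M]. The volume then costs a factor [exp(M)], and one
   more [M] is given up so that the root has exponent [3 M]. *)
have eph : expR (8 * M) / 2 <= ph.
  have : expR (8 * M) <= expR (s * (rho - D y)).
    rewrite ler_expR -sq_eq.
    by rewrite ler_pM2l//; lra.
  have : 1 + 8 * M <= expR (8 * M) by exact: expR_ge1Dx.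
  by rewrite /ph; lra.
have ph0 : 0 < ph.
  by apply: lt_le_trans eph; rewrite divr_gt0 ?expR_gt0.
have h1 : (Num.sqrt c0 * (v K y * ph)) ^+ 2 <= expR M ^+ 2.
  rewrite exprMn sqr_sqrtr ?(ltW c0_gt0)//; apply: (@le_trans _ _ (expR M)).
    apply: le_trans vol_le; apply: le_trans hl2.
    by rewrite ler_wpM2r ?sqr_ge0.
  rewrite expr2 ler_peMr ?expR_ge0// -expR0 ler_expR; lra.
rewrite ler_sqr ?nnegrE ?expR_ge0// in h1; last first.
  by apply: mulr_ge0; [exact: ltW|apply: mulr_ge0 => //; exact: ltW].
have h2 : v K y * ph <= expR M / Num.sqrt c0.
  by rewrite ler_pdivlMr// mulrC.
have h3 : v K y * (expR (8 * M) / 2) <= expR M / Num.sqrt c0.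
  by apply: le_trans h2; rewrite ler_wpM2l.
have h4 : v K y <= 2 / Num.sqrt c0 * (expR M * expR (- (8 * M))).
  rewrite expRN -(ler_pM2r (_ : 0 < expR (8 * M) / 2)); last by rewrite divr_gt0 ?expR_gt0.
  apply: le_trans h3 _; rewrite le_eqVlt; apply/orP; left; apply/eqP; field.
  by rewrite !gt_eqF ?expR_gt0.
apply: le_trans h4 _; rewrite ler_wpM2l ?(divr_ge0 _ (ltW sc0))//.
by rewrite -expRD expr2 -expRD ler_expR; lra.
Qed.

Context (d : measure_display) (Omega : measurableType d).
Variables (P : probability Omega R) (Y : nat -> Omega -> V) (E : nat -> Omega -> R).
Variables (x0 : V) (rho1 : R).
Hypothesis chain : minimal_chain w mu x0 P Y E.
Hypothesis x0_le : D x0 <= rho1 + 1.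
Hypothesis gap : rho1 + 1 <= rho - q.

(** A jump out of the smaller ball overshoots by at most 1, the largest edge length; hence
    [rho1 + 1] in [gap]. *)
Lemma annulus_prob :
  (P (crossing w mu sigma (fun x => D x <= rho1)%R (fun x => D x <= rho)%R
       (s ^+ 2 / 2) fast_rate M Y E) <= (annulus_const * expR (- (2 * M)))%:E)%E.
Proof.
have -> : annulus_const * expR (- (2 * M)) = expR M * (annulus_const * expR (- (3 * M))).
  rewrite mulrCA -expRD; congr (_ * expR _); ring.
have fr0 : 0 <= fast_rate.
  by rewrite divr_ge0 ?(ltW (hold_rate_gt0 R))// ltW// mulr_gt0 ?exprn_gt0// mulr_gt0 ?expR_gt0.
apply: (prob_crossing graph_w M fr0 chain).
  by rewrite mulr_ge0 ?expR_ge0 ?sqrtr_ge0.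
move=> K y _ hy; apply: annulus_inner_mean; apply: le_trans gap.
case: hy => [->//|[z zB zy]].
apply: le_trans (dist_edge1 graph_w adapted_sigma xbar zy) _.
by rewrite lerD2r.
Qed.

End Annulus.

Context (d : measure_display) (Omega : measurableType d).
Variables (P : probability Omega R) (Y : nat -> Omega -> V) (E : nat -> Omega -> R).
Variables (x0 : V).
Hypothesis chain : minimal_chain w mu x0 P Y E.

(** With [pred0] as first set the window starts at index 0. For negative [l], the event says that
    the sum of [sigma^2] up to the exit exceeds [slow_rate] times the elapsed time by at least
    [- l]. *)
Lemma slow_prob (B2 : pred V) l :
  (P (crossing w mu sigma pred0 B2 (-1) slow_rate l Y E) <= (expR l)%:E)%E.
Proof.
rewrite -[expR l]mulr1; apply: (prob_crossing graph_w _ _ chain) => //.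
  exact/ltW/slow_rate_gt0.
by move=> K y _ _; exact: slow_inner_mean_le1.
Qed.

End CrossingEstimates.

(** * Integrals of r/N(r) for monotone N *)

Section MonotoneRatio.
Variables (R : realType) (N : R -> R) (A : R).
Hypothesis A_ge0 : 0 <= A.
Hypothesis N_gt0 : forall r, A <= r -> 0 < N r.
Hypothesis N_incr : forall r r', A <= r -> r <= r' -> N r <= N r'.
Local Notation leb := (@lebesgue_measure R).

Definition ratio_integral r : R := Rintegral leb `[A, r]%classic (fun t => t / N t).

Lemma ratio_ge0 r : A <= r -> 0 <= r / N r.
Proof.
by move=> Ar; apply: divr_ge0; [exact: le_trans Ar|exact/ltW/N_gt0].
Qed.

Lemma measurable_ratio (D : set R) : measurable D -> D `<=` `[A, +oo[%classic ->
  measurable_fun D (fun t => t / N t).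
Proof.
move=> mD DA.
(* [N] is known to be monotone on [[A, oo)] only; freezing it below [A] gives a monotone function on
   the line. *)
have mN : measurable_fun D (fun t => t * (N (Num.max t A))^-1).
  apply: measurable_funM; first exact: measurable_id.
  apply: nonincreasing_measurable => // s t st.
  have h u : A <= Num.max u A by rewrite le_max lexx orbT.
  rewrite lef_pV2 ?posrE ?N_gt0//; apply: N_incr => //.
  by rewrite ge_max !le_max st lexx orbT.
apply: eq_measurable_fun mN => t /set_mem /DA /=; rewrite in_itv/= andbT => At.
by rewrite max_l.
Qed.

Lemma integrable_ratio r : leb.-integrable `[A, r]%classic (EFin \o (fun t => t / N t)).
Proof.
apply: measurable_bounded_integrable => //.
- by rewrite /= lebesgue_measure_itv/=; case: ifPn => // _; rewrite -EFinB ltry.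
- apply: measurable_ratio => // t /=; rewrite !in_itv/= => /andP[->//].
exists (r / N A); split; first exact: num_real.
move=> x hx t /=; rewrite in_itv/= => /andP[At tr].
rewrite ger0_norm ?ratio_ge0//; apply: le_trans (ltW hx).
have NA := N_gt0 (lexx A); have Nt := N_gt0 At.
apply: ler_pM => //; first exact: le_trans At.
  by rewrite invr_ge0 ltW.
by rewrite lef_pV2 ?posrE// N_incr.
Qed.

Lemma ratio_integralB r1 r2 : A <= r1 -> r1 <= r2 ->
  (r2 - r1) * (r1 / N r2) <= ratio_integral r2 - ratio_integral r1 <=
  (r2 - r1) * (r2 / N r1).
Proof.
move=> Ar1 r12; have Ar2 := le_trans Ar1 r12.
have N1 := N_gt0 Ar1; have N2 := N_gt0 Ar2.
rewrite /ratio_integral Rintegral_itvB ?bnd_simp//; last exact: integrable_ratio.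
have len : fine (leb `]r1, r2]%classic) = r2 - r1.
  rewrite lebesgue_measure_itv/= lte_fin; case: ltP => //= r21.
  by apply/eqP; rewrite eq_sym subr_eq0 eq_le r12 r21.
have fin : (leb `]r1, r2]%classic < +oo)%E.
  by rewrite lebesgue_measure_itv/=; case: ifPn => // _; rewrite -EFinB ltry.
have ig : leb.-integrable `]r1, r2]%classic (EFin \o (fun t => t / N t)).
  apply: integrableS (integrable_ratio r2) => //.
  by apply: subset_itvr; rewrite bnd_simp.
have ic c : leb.-integrable `]r1, r2]%classic (EFin \o (fun=> c)).
  apply: measurable_bounded_integrable => //; exact: bounded_cst.
have bnd t : `]r1, r2]%classic t -> [/\ A <= t, r1 <= t & t <= r2].
  by move=> /=; rewrite in_itv/= => /andP[/ltW r1t ->]; split => //; exact: le_trans r1t.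
apply/andP; split.
  rewrite mulrC -len -Rintegral_cst//; apply: le_Rintegral => // t /bnd[At r1t tr2].
  apply: ler_pM => //; first exact: le_trans Ar1.
    by rewrite invr_ge0 ltW.
  by rewrite lef_pV2 ?posrE ?N_gt0// N_incr.
rewrite mulrC -len -Rintegral_cst//; apply: le_Rintegral => // t /bnd[At r1t tr2].
apply: ler_pM => //; first exact: le_trans At.
  by rewrite invr_ge0 ltW// N_gt0.
by rewrite lef_pV2 ?posrE ?N_gt0// N_incr.
Qed.

Lemma ratio_integral_start : ratio_integral A = 0.
Proof. by rewrite /ratio_integral set_itv1 Rintegral_set1. Qed.

Lemma ratio_integral_incr r1 r2 : A <= r1 -> r1 <= r2 ->
  ratio_integral r1 <= ratio_integral r2.
Proof.
move=> Ar1 r12; have /andP[h _] := ratio_integralB Ar1 r12.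
rewrite -subr_ge0; apply: le_trans h; rewrite mulr_ge0 ?subr_ge0//.
apply: divr_ge0; first exact: le_trans Ar1.
exact/ltW/N_gt0/(le_trans Ar1).
Qed.

Lemma ratio_integral_lt r1 r2 : A <= r1 -> r1 < r2 ->
  ratio_integral r1 < ratio_integral r2.
Proof.
(* The lower bound [(r2 - r1) r1 / N r2] vanishes when [r1 = 0]; starting from the midpoint keeps it
   positive. *)
move=> Ar1 r12; pose m := (r1 + r2) / 2.
have m1 : r1 < m by rewrite /m; lra.
have m2 : m < r2 by rewrite /m; lra.
apply: (@le_lt_trans _ _ (ratio_integral m)); first exact: ratio_integral_incr (ltW m1).
have Am : A <= m by exact: le_trans (ltW m1).
have /andP[h _] := ratio_integralB Am (ltW m2).
rewrite -subr_gt0; apply: lt_le_trans h; rewrite mulr_gt0 ?subr_gt0//.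
apply: divr_gt0; first by apply: le_lt_trans m1; exact: le_trans Ar1.
exact/N_gt0/(le_trans Am (ltW m2)).
Qed.

(** [N] may jump, as ball volumes do, but the integral is Lipschitz on bounded intervals, so the
    intermediate value theorem applies. *)
Lemma ratio_integral_onto t r : A <= r -> 0 <= t -> t <= ratio_integral r ->
  exists2 r', A <= r' & ratio_integral r' = t.
Proof.
move=> Ar t0 tr.
have NA := N_gt0 (lexx A).
pose C := r / N A.
have C0 : 0 <= C by rewrite divr_ge0 ?(ltW NA)//; exact: le_trans Ar.
have lip x y : A <= x -> x <= y -> y <= r ->
    `|ratio_integral y - ratio_integral x| <= C * (y - x).
  move=> Ax xy yr; have /andP[_ h] := ratio_integralB Ax xy.
  rewrite ger0_norm ?subr_ge0 ?ratio_integral_incr//.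
  apply: le_trans h _; rewrite mulrC ler_wpM2r ?subr_ge0//.
  apply: ler_pM => //.
  - exact: le_trans (le_trans Ax xy).
  - by rewrite invr_ge0 (ltW (N_gt0 Ax)).
  by rewrite lef_pV2 ?posrE ?N_gt0// N_incr.
have cont : {within `[A, r], continuous ratio_integral}.
  apply/subspace_continuousP => x /=; rewrite in_itv/= => /andP[Ax xr].
  apply/cvgrPdist_le => e e0; near=> y.
  have : `[A, r]%classic y by near: y; exact: withinT.
  rewrite /= in_itv/= => /andP[Ay yr].
  have xy : `|x - y| <= e / (C + 1).
    near: y; apply: cvg_within; apply/nbhs_ballP; exists (e / (C + 1)) => /=.
      by rewrite divr_gt0//; lra.
    by move=> z; rewrite -ball_normE/= => /ltW.
  have hC : C * `|x - y| <= e.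
    apply: (@le_trans _ _ ((C + 1) * `|x - y|)); first by rewrite ler_wpM2r//; lra.
    by rewrite mulrC -ler_pdivlMr//; lra.
  apply: le_trans hC; have [h|/ltW h] := leP x y.
    by rewrite distrC [X in C * X]distrC [X in C * X]ger0_norm ?subr_ge0// lip.
  by rewrite [X in C * X]ger0_norm ?subr_ge0// lip.
have hI : ratio_integral A <= ratio_integral r by exact: ratio_integral_incr.
have [|c + hc] := @IVT R ratio_integral A r t Ar cont.
  by rewrite (min_l hI) (max_r hI) ratio_integral_start t0 tr.
by rewrite in_itv/= => /andP[Ac _]; exists c.
Unshelve. all: by end_near.
Qed.

End MonotoneRatio.

(** * Divergence survives the added iterated logarithm *)

Section Divergence.
Variables (R : realType) (L : R -> R) (a A : R).
Hypothesis a_ge0 : 0 <= a.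
Hypothesis L_gt0 : forall r, a <= r -> 0 < L r.
Hypothesis L_incr : forall r r', a <= r -> r <= r' -> L r <= L r'.
Hypothesis L_div :
  (\int[@lebesgue_measure R]_(r in `[a, +oo[%classic) (r / L r)%:E = +oo)%E.
Hypothesis aA : a <= A.
Hypothesis A_large : expR (expR 1) <= A.

Definition denom (r : R) : R := L r + ln (ln r).

Lemma lnln_ge1 r : A <= r -> 1 <= ln (ln r).
Proof.
move=> Ar; have h := le_trans A_large Ar.
have l1 : expR 1 <= ln r by rewrite -[leLHS]expRK ler_ln ?posrE ?expR_gt0// (lt_le_trans _ h) ?expR_gt0.
by rewrite -[leLHS]expRK ler_ln ?posrE ?expR_gt0// (lt_le_trans _ l1) ?expR_gt0.
Qed.

Lemma lnln_incr r r' : A <= r -> r <= r' -> ln (ln r) <= ln (ln r').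
Proof.
move=> Ar rr'; have h := le_trans A_large Ar.
have r0 : 0 < r by apply: lt_le_trans h; exact: expR_gt0.
have l1 : expR 1 <= ln r by rewrite -[leLHS]expRK ler_ln ?posrE ?expR_gt0.
have l0 : 0 < ln r by apply: lt_le_trans l1; exact: expR_gt0.
have ll : ln r <= ln r' by rewrite ler_ln ?posrE// (lt_le_trans r0).
by rewrite ler_ln ?posrE// (lt_le_trans l0).
Qed.

Lemma lnln_le r : A <= r -> ln (ln r) <= r.
Proof.
move=> Ar; have h := le_trans A_large Ar.
have r0 : 0 < r by apply: lt_le_trans h; exact: expR_gt0.
have l1 : expR 1 <= ln r by rewrite -[leLHS]expRK ler_ln ?posrE ?expR_gt0.
have l0 : 0 < ln r by apply: lt_le_trans l1; exact: expR_gt0.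
have lnle (x : R) : 0 < x -> ln x <= x.
  move=> x0; rewrite -[leRHS]expRK ler_ln ?posrE ?expR_gt0//.
  by have := expR_ge1Dx x; lra.
exact: le_trans (lnle _ l0) (lnle _ r0).
Qed.

Lemma denom_ge1 r : A <= r -> 1 <= denom r.
Proof.
move=> Ar; have := lnln_ge1 Ar; have := L_gt0 (le_trans aA Ar).
by rewrite /denom; lra.
Qed.

Lemma denom_gt0 r : A <= r -> 0 < denom r.
Proof. by move=> Ar; apply: lt_le_trans (denom_ge1 Ar). Qed.

Lemma denom_incr r r' : A <= r -> r <= r' -> denom r <= denom r'.
Proof.
by move=> Ar rr'; apply: lerD; [exact/L_incr/rr'/(le_trans aA)|exact: lnln_incr].
Qed.

Let A_ge0 : 0 <= A. Proof. exact: le_trans aA. Qed.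

(** Either [log log r <= L r] from some point on, and the denominator at most doubles; or
    [L rho < log log rho] for arbitrarily large [rho], and the single interval [[rho/2, rho]]
    contributes at least [rho/8]. *)
Lemma ratio_integral_unbounded (C : R) :
  exists2 r, A <= r & C <= ratio_integral denom A r.
Proof.
have A1 : 1 <= A.
  apply: le_trans A_large; have := expR_ge1Dx (expR 1 : R); have := expR_gt0 (1 : R); lra.
have [[rs Ars hrs]|nrs] := pselect (exists2 rs, A <= rs & forall r, rs <= r -> ln (ln r) <= L r);
    last first.
  pose rho0 := Num.max (2 * A) (Num.max 0 (8 * C)).
  have r1 : 2 * A <= rho0 by rewrite /rho0 le_max lexx.
  have r2 : 8 * C <= rho0 by rewrite /rho0 !le_max lexx !orbT.
  have [rho rho1 rho2] : exists2 rho, rho0 <= rho & L rho < ln (ln rho).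
    apply: contrapT => /forall2NP h; apply: nrs; exists rho0; first by lra.
    by move=> r hr; have [//|/negP] := h r; rewrite -leNgt.
  exists rho; first lra.
  have Ah : A <= rho / 2 by lra.
  have hh : rho / 2 <= rho by lra.
  have /andP[h _] := ratio_integralB A_ge0 denom_gt0 denom_incr Ah hh.
  have I0 : 0 <= ratio_integral denom A (rho / 2).
    rewrite -(ratio_integral_start denom A).
    exact: (ratio_integral_incr A_ge0 denom_gt0 denom_incr).
  have Ar : A <= rho by lra.
  have d0 := denom_gt0 Ar.
  have dr : denom rho <= 2 * rho by have := lnln_le Ar; rewrite /denom; lra.
  have : rho / 8 <= (rho - rho / 2) * (rho / 2 / denom rho).
    rewrite mulrA ler_pdivlMr//.
    apply: (@le_trans _ _ (rho / 8 * (2 * rho))); last by nra.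
    by rewrite ler_wpM2l//; lra.
  by lra.
(* If the modified integral stayed below [C], the original one would be finite up to [rs] and at
   most [2 C] beyond it. *)
apply: contrapT => /forall2NP h.
have IC r : A <= r -> ratio_integral denom A r <= C.
  by move=> Ar; have [//|/negP] := h r; rewrite -ltNge => /ltW.
have ars := le_trans aA Ars.
have fA : (\int[@lebesgue_measure R]_(r in `[a, rs]%classic) (r / L r)%:E < +oo)%E.
  have /integrableP[_ +] := integrable_ratio a_ge0 L_gt0 L_incr rs.
  apply: le_lt_trans; apply: ge0_le_integral => //.
  - move=> r /=; rewrite in_itv/= => /andP[ar _]; rewrite lee_fin.
    exact: (ratio_ge0 a_ge0 L_gt0).
  - apply/measurable_EFinP; apply: (measurable_ratio L_gt0 L_incr) => // t /=.
    by rewrite !in_itv/= => /andP[->].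
  - apply: measurableT_comp => //; apply/measurable_EFinP; apply: (measurable_ratio L_gt0 L_incr) => // t /=.
    by rewrite !in_itv/= => /andP[->].
  - by move=> r _ /=; rewrite lee_fin ler_norm.
have fB : (\int[@lebesgue_measure R]_(r in `]rs, +oo[%classic) (r / L r)%:E <= (2 * C)%:E)%E.
  pose F n := `]rs, rs + n%:R]%classic.
  have Fsub n t : F n t -> [/\ a <= t, A <= t, rs <= t & t <= rs + n%:R].
    rewrite /F/= in_itv/= => /andP[/ltW rt tn]; split => //.
      exact: le_trans rt.
    exact: le_trans rt.
  have FU : \bigcup_n F n = `]rs, +oo[%classic.
    apply/seteqP; split => [t [n _]|t]; rewrite /F/= !in_itv/=.
      by move=> /andP[->].
    rewrite andbT => rt; exists (Num.bound (t - rs)) => //=; rewrite in_itv/= rt/=.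
    have := archi_boundP (_ : 0 <= t - rs); rewrite subr_ge0 (ltW rt) => /(_ isT).
    by lra.
  have mF n : measurable (F n) by exact: measurable_itv.
  have mfF n : measurable_fun (F n) (fun r => (r / L r)%:E).
    apply/measurable_EFinP; apply: (measurable_ratio L_gt0 L_incr) => // t /Fsub[at_ _ _ _].
    by rewrite /= in_itv/= at_.
  have F0 n t : F n t -> (0 <= (t / L t)%:E)%E.
    by move=> /Fsub[at_ _ _ _]; rewrite lee_fin; exact: (ratio_ge0 a_ge0 L_gt0).
  have ndF : nondecreasing_seq F.
    move=> m n mn; apply/subsetPset => t; rewrite /F/= !in_itv/= => /andP[-> tm]/=.
    by apply: le_trans tm _; rewrite lerD2l ler_nat.
  have cv : (\int[@lebesgue_measure R]_(t in F n) (t / L t)%:E)%E @[n --> \oo] -->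
      (\int[@lebesgue_measure R]_(t in \bigcup_n F n) (t / L t)%:E)%E.
    exact: ge0_nondecreasing_set_cvg_integral.
  rewrite FU in cv; rewrite -(cvg_lim _ cv)//; apply: lime_le.
    by apply/cvg_ex; eexists; exact: cv.
  apply: nearW => n.
  have rn : rs <= rs + n%:R by rewrite lerDl.
  have ig2 : (@lebesgue_measure R).-integrable (F n) (EFin \o (fun t => t / denom t)).
    apply: integrableS (integrable_ratio A_ge0 denom_gt0 denom_incr (rs + n%:R)) => //.
      exact: measurable_itv.
    by move=> t /Fsub[_ At _ tn]; rewrite /= in_itv/= At.
  have ig : (@lebesgue_measure R).-integrable (F n) (EFin \o (fun t => 2 * (t / denom t))).
    by apply: (integrableZl _ 2 ig2); exact: measurable_itv.
  apply: (@le_trans _ _ (\int[@lebesgue_measure R]_(t in F n) (2 * (t / denom t))%:E)%E).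
    apply: ge0_le_integral => //.
    - exact: measurable_itv.
    - exact: F0.
    - exact: mfF.
    - by case/integrableP: ig.
    move=> t /Fsub[at_ At rt _]; rewrite lee_fin.
    have l0 := L_gt0 at_; have d0 := denom_gt0 At; have t0 : 0 <= t by exact: le_trans at_.
    rewrite mulrCA ler_wpM2l// -[leLHS]mul1r ler_pdivrMr// mulrAC ler_pdivlMr// mul1r.
    by have := hrs _ rt; rewrite /denom; lra.
  rewrite -[leLHS]fineK; last by apply: integrable_fin_num ig; exact: measurable_itv.
  rewrite lee_fin.
  rewrite -/(Rintegral (@lebesgue_measure R) (F n) (fun t => 2 * (t / denom t))).
  rewrite RintegralZl ?ler_pM2l//; last exact: measurable_itv.
  rewrite /F -(@Rintegral_itvB _ _ (BLeft A) (BRight (rs + n%:R)) rs) ?bnd_simp//; last first.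
    exact: (integrable_ratio A_ge0 denom_gt0 denom_incr).
  have := IC _ (le_trans Ars rn).
  have : 0 <= ratio_integral denom A rs.
    rewrite -(ratio_integral_start denom A).
    exact: (ratio_integral_incr A_ge0 denom_gt0 denom_incr).
  by rewrite /ratio_integral; lra.
move: L_div; rewrite (@itv_bndbnd_setU _ _ _ (BRight rs)) ?bnd_simp//.
rewrite ge0_integral_setU//=.
- by move=> e; have := lte_add_pinfty fA (le_lt_trans fB (ltry _)); rewrite e ltxx.
- rewrite -itv_bndbnd_setU ?bnd_simp//; apply/measurable_EFinP.
  exact: (measurable_ratio L_gt0 L_incr).
- move=> t ht; have at_ : a <= t.
    case: ht; rewrite in_itv/= => /andP[//]; move=> rt _.
    exact: le_trans (ltW rt).
  by rewrite lee_fin; exact: (ratio_ge0 a_ge0 L_gt0).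
apply/disj_setPS => t [/=]; rewrite !in_itv/= => /andP[_ h1] /andP[h2 _].
by move: h2; rewrite ltNge h1.
Qed.

End Divergence.

(** * Borel-Cantelli and measurable choice of an index *)

Section BorelCantelli.
Context (d : measure_display) (T : measurableType d) (R : realType).
Variable P : probability T R.

(** Telescoping of [1/x^2 <= 2/x - 2/(x + 1)], valid for [x >= 1]. *)
Lemma sum_inv_sqr_le n : \sum_(0 <= k < n) (k.+1%:R ^+ 2 : R)^-1 <= 3 - 2 / n.+1%:R.
Proof.
elim: n => [|n IH]; first by rewrite big_geq// divr1; lra.
rewrite big_nat_recr//=; apply: (le_trans (lerD IH (lexx _))).
have x0 : (0 : R) < n.+1%:R by rewrite ltr0n.
rewrite -[n.+2%:R]natr1; set x := n.+1%:R in x0 *.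
have x1 : 1 <= x by rewrite /x ler1n.
rewrite -subr_ge0.
have -> : 3 - 2 / (x + 1) - (3 - 2 / x + (x ^+ 2)^-1) = (x - 1) / (x ^+ 2 * (x + 1)).
  by field; rewrite !gt_eqF//; lra.
by rewrite divr_ge0 ?subr_ge0// mulr_ge0 ?sqr_ge0//; lra.
Qed.

Lemma borel_cantelli_inv_sqr (F : nat -> set T) (C : R) : 0 <= C ->
  (forall n, measurable (F n)) ->
  (forall n, (P (F n) <= (C * (n.+1%:R ^+ 2)^-1)%:E)%E) ->
  P [set om | exists m, forall n, (m <= n)%N -> ~ F n om] = 1%E.
Proof.
move=> C0 mF PF.
have mS : measurable [set om | exists m, forall n, (m <= n)%N -> ~ F n om].
  apply: (@measurable_exists _ _ (fun m => [set om | forall n, (m <= n)%N -> ~ F n om])) => m.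
  apply: (@measurable_forall _ _ (fun n => [set om | (m <= n)%N -> ~ F n om])) => n.
  by apply: measurable_imply; exact: measurableC.
apply/prob1P => //.
rewrite (_ : ~` _ = lim_sup_set F).
  apply: lim_sup_set_cvg0 => //.
  apply: (@le_lt_trans _ _ (C * 3)%:E); last exact: ltry.
  apply: lime_le; first by apply: is_cvg_nneseries => n _ _; exact: measure_ge0.
  apply: nearW => n.
  apply: (@le_trans _ _ (\sum_(0 <= k < n) (C * (k.+1%:R ^+ 2)^-1)%:E)%E).
    by apply: lee_sum => k _; exact: PF.
  rewrite sumEFin lee_fin -mulr_sumr ler_wpM2l//; apply: le_trans (sum_inv_sqr_le n) _.
  by rewrite gerBl divr_ge0.
apply/seteqP; split => om /=.
  move=> h n _; apply: contrapT => h'; apply: h; exists n => k nk Fk; apply: h'.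
  by exists k.
by move=> h [m hm]; have [k /= mk /(hm _ mk)] := h m I.
Qed.

Lemma measurable_countable_valued (m : T -> nat) (tau : nat -> R) :
  (forall k, measurable [set om | m om = k]) ->
  measurable_fun setT (fun om => tau (m om)).
Proof. by move=> mm; exact: measurable_fun_discrete. Qed.

(** Least index where one exists and 0 elsewhere, so that [m] is total and measurable; it will
    produce the random time of the rate function. *)
Lemma measurable_first_index (G : nat -> set T) : (forall k, measurable (G k)) ->
  exists m : T -> nat, (forall k, measurable [set om | m om = k]) /\
    (forall om, (exists k, G k om) -> G (m om) om).
Proof.
move=> mG.
pose first k om := G k om /\ forall i, (i < k)%N -> ~ G i om.
have ex om : exists k, (exists k, G k om) -> first k om.
  have [[k0 Gk0]|no] := pselect (exists k, G k om); last by exists 0%N => /no.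
  have exb : exists k, `[< G k om >] by exists k0; apply/asboolP.
  exists (ex_minn exb) => _; case: ex_minnP => k /asboolP Gk mink; split => // i ik Gi.
  by have := mink i (asboolT Gi); rewrite leqNgt ik.
have mfirst k : measurable [set om | first k om].
  apply: measurableI => //.
  apply: (@measurable_forall _ _ (fun i => [set om | (i < k)%N -> ~ G i om])) => i.
  by apply: measurable_imply; exact: measurableC.
have mno : measurable [set om | forall k, ~ G k om].
  by apply: (@measurable_forall _ _ (fun k => ~` G k)) => k; exact: measurableC.
have /choice[m hm] : forall om, exists k,
    ((exists k, G k om) -> first k om) /\ ((forall k, ~ G k om) -> k = 0%N).
  move=> om; have [h|h] := pselect (exists k, G k om).
    have [k hk] := ex om; exists k; split => // h'.
    by case: h => k' /h'.
  exists 0%N; split => // h'; by case: h.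
exists m; split; last by move=> om /(hm om).1[].
move=> k; have -> : [set om | m om = k] = [set om | first k om] `|`
    [set om | k = 0%N /\ forall k, ~ G k om].
  apply/seteqP; split => om /=.
    move=> <-; have [h|h] := pselect (exists k, G k om).
      by left; exact: (hm om).1.
    right; have h' : forall k, ~ G k om by move=> k' Gk'; apply: h; exists k'.
    by split => //; exact: (hm om).2.
  move=> [[Gk hk]|[-> h]]; last exact: (hm om).2.
  have [Gm hm'] := (hm om).1 (ex_intro _ k Gk).
  case: (ltngtP (m om) k) => // h; first by case: (hk _ h).
  by case: (hm' _ h).
apply: measurableU; first exact: mfirst.
have [->|k0] := eqVneq k 0%N.
  by rewrite (_ : mkset _ = [set om | forall k, ~ G k om])//; apply/seteqP; split => om //= -[].
rewrite (_ : mkset _ = set0)//; apply/seteqP; split => om //= -[/eqP].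
by rewrite (negbTE k0).
Qed.

End BorelCantelli.

(** * Deterministic lower bound for the clock along one trajectory *)

Section Trajectory.
Variables (R : realType) (V : countType).
Variables (w : V -> V -> R) (mu : V -> R) (sigma : V -> V -> R).
Hypothesis graph_w : simple_weighted_graph w mu.
Local Notation h := (mean_hold w mu).
Variables (D : V -> R) (t : nat -> R) (y : nat -> V) (e : nat -> R).
Variables (n0 m : nat) (C1 C2 : R).
Hypothesis e_gt0 : forall j, 0 < e j.
Hypothesis t_ge0 : forall n, 0 <= t n.
Hypothesis C1_ge0 : 0 <= C1.
Hypothesis C2_ge0 : 0 <= C2.
Hypothesis m_ge : (n0 <= m)%N.

(** With radius [2^n - 1] instead of [2^n], a vertex reached by jumping out still lies within [2^n],
    edges having length at most 1. *)
Definition leaves n i := exits_at (fun x => D x <= 2 ^+ n - 1) y i.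
Definition total n : R := \sum_(n0 <= j < n) t j.
Definition clock k : R := \sum_(0 <= j < k) h (y j) * e j.
Definition mixed_cost i k : R :=
  \sum_(i <= j < k) (sigma (y j) (y j.+1) ^+ 2 + C1 * (h (y j) * e j)).

Hypothesis good_annulus : forall n, (m <= n)%N -> forall i k, (i <= k)%N ->
  leaves n i -> leaves n.+1 k -> t n <= mixed_cost i k.

Lemma total_incr n n' : (n <= n')%N -> total n <= total n'.
Proof.
move=> nn'; have [n0n|nn0] := leqP n0 n.
  rewrite /total [leRHS](big_cat_nat n0n nn')/= lerDl.
  exact: sumr_ge0.
rewrite {1}/total big_geq ?(ltnW nn0)//.
exact: sumr_ge0.
Qed.

Lemma clock_incr k k' : (k <= k')%N -> clock k <= clock k'.
Proof.
move=> kk'; rewrite /clock [leRHS](big_cat_nat (leq0n k) kk')/= lerDl.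
by apply: sumr_ge0 => j _; rewrite mulr_ge0 ?(ltW (e_gt0 _))// ltW// (mean_hold_gt0 graph_w).
Qed.

Lemma mixed_cost_ge0 i k : 0 <= mixed_cost i k.
Proof.
apply: sumr_ge0 => j _; rewrite addr_ge0 ?sqr_ge0//; apply: mulr_ge0 => //.
by rewrite mulr_ge0 ?(ltW (e_gt0 _))// ltW// (mean_hold_gt0 graph_w).
Qed.

Lemma leaves_smaller n n' k : (n <= n')%N -> leaves n' k ->
  exists2 i, (i <= k)%N & leaves n i.
Proof.
move=> nn' [hk nk].
have ex : exists i, ~~ (D (y i) <= 2 ^+ n - 1).
  exists k; apply: contra nk => /le_trans; apply.
  by rewrite lerD2r ler_weXn2l// ler1n.
exists (ex_minn ex); case: ex_minnP => i ni mini.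
  apply: mini; apply: contra nk => /le_trans; apply.
  by rewrite lerD2r ler_weXn2l// ler1n.
by split => // j ji; apply: contraLR ji => /mini; rewrite -leqNgt.
Qed.

(** The windows between successive exits are disjoint and their costs add up; subtracting [total m]
    pays for the scales below [m], where nothing is known. *)
Lemma mixed_cost_lower n k : leaves n k -> total n - total m <= mixed_cost 0 k.
Proof.
have [nm|] := leqP n m.
  move=> _; apply: le_trans (mixed_cost_ge0 0 k).
  by rewrite subr_le0 total_incr.
move=> mn; have := ltnW mn; rewrite -(subnK (ltnW mn)) => _; move: (n - m)%N => p.
elim: p k => [|p IH] k lk; first by rewrite add0n subrr mixed_cost_ge0.
rewrite addSn in lk *.
have [i ik li] := leaves_smaller (leqnSn (p + m)) lk.
have h1 := IH _ li.
have h2 := good_annulus (leq_addl p m) ik li lk.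
rewrite /mixed_cost (big_cat_nat (leq0n i) ik)/= /total big_nat_recr/=; last first.
  exact: leq_trans m_ge (leq_addl _ _).
by move: h1 h2; rewrite /mixed_cost /total; lra.
Qed.

Variable nj : nat -> nat.
Hypothesis nj_ge : forall j, j%:R <= total (nj j).
Hypothesis nj_min : forall j n, j%:R <= total n -> (nj j <= n)%N.
Hypothesis good_slow : forall j, (m <= j)%N -> forall k, leaves (nj j) k ->
  \sum_(0 <= i < k) sigma (y i) (y i.+1) ^+ 2 <= C2 * clock k + total (nj j) / 2.

(** The sum of [sigma^2] is controlled only at the exits [nj j], so [n] is lowered to [nj j] with
    [j] the integer part of [total n], which loses at most 1. There the uncontrolled part of that
    sum is at most half of the accumulated bound, and the other half is left for the clock. *)
Lemma clock_lower n k : m%:R <= total n -> leaves n k ->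
  (total n - 1) / 2 - total m <= (C1 + C2) * clock k.
Proof.
move=> mT lk; have T0 : 0 <= total n by apply: le_trans mT; rewrite ler0n.
pose j := Num.truncn (total n).
have /andP[jT Tj] : j%:R <= total n < j.+1%:R by exact: truncn_itv.
have mj : (m <= j)%N by rewrite -ltnS -(ltr_nat R); exact: le_lt_trans Tj.
have [i ik li] := leaves_smaller (nj_min jT) lk.
have h1 := mixed_cost_lower li.
have h2 := good_slow mj li.
have h3 : mixed_cost 0 i = \sum_(0 <= l < i) sigma (y l) (y l.+1) ^+ 2 + C1 * clock i.
  by rewrite /mixed_cost big_split/= -mulr_sumr.
have h4 := nj_ge j; rewrite -natr1 in Tj.
have h5 : (total n - 1) / 2 - total m <= (C1 + C2) * clock i by lra.
apply: le_trans h5 _.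
by apply: ler_wpM2l; [exact: addr_ge0|exact: clock_incr].
Qed.

End Trajectory.

Lemma pow2_unbounded (R : realType) (x : R) : exists n, x <= 2 ^+ n.
Proof.
exists (Num.bound x); have [x0|x0] := leP 0 x; last first.
  by apply: le_trans (ltW x0) _; rewrite exprn_ge0.
apply: le_trans (ltW (archi_boundP x0)) _.
by rewrite -natrX ler_nat ltnW// ltn_expl.
Qed.

Lemma fset_lower_bound (R : realType) (V : choiceType) (U : {fset V}) (f : V -> R) :
  (forall x, 0 < f x) -> exists2 eta, 0 < eta & forall x, x \in U -> eta <= f x.
Proof.
move=> f0; suff [eta eta0 h] : exists2 eta, 0 < eta & forall x, x \in (U : seq V) -> eta <= f x.
  by exists eta.
elim: (U : seq V) => [|y r [eta eta0 IH]]; first by exists 1.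
exists (Num.min eta (f y)); first by rewrite lt_min eta0 f0.
move=> x; rewrite inE => /orP[/eqP ->|/IH h]; rewrite ge_min ?lexx ?orbT//.
by rewrite h.
Qed.

(** * Dyadic scales and constants for the given graph *)

Section Assembly.
Variables (R : realType) (V : countType).
Variables (w : V -> V -> R) (mu : V -> R) (sigma : V -> V -> R) (xbar : V).
Hypothesis graph_w : simple_weighted_graph w mu.
Hypothesis adapted_sigma : adapted_weight w mu sigma.
Hypothesis mu_inf : 0 < inf [set mu x | x in [set: V]].
Variable a : R.
Hypothesis vol_a : forall r, a <= r ->
  (1 < vol mu (ball_d (adapted_dist w sigma) xbar r) < +oo)%E.
Hypothesis vol_div :
  (\int[lebesgue_measure]_(r in `[a, +oo[%classic)
    (r / ln (fine (vol mu (ball_d (adapted_dist w sigma) xbar r))))%:E = +oo)%E.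
Local Notation dist := (adapted_dist w sigma).
Local Notation D := (dist xbar).
Local Notation ball := (ball_d dist xbar).
Local Notation c0 := (inf [set mu x | x in [set: V]]).
Local Notation L := (fun r : R => ln (fine (vol mu (ball r)))).

Lemma inf_mass_le x : c0 <= mu x.
Proof.
by apply: ge_inf; [exists 0 => _ [y _ <-]; exact/ltW/(mass_gt0 graph_w)|exists x].
Qed.

Lemma vol_subset (A B : set V) : A `<=` B -> (vol mu A <= vol mu B)%E.
Proof.
move=> AB; apply: le_ereal_sup => _ [X [fX XA] <-]; exists X => //.
by split => //; exact: subset_trans AB.
Qed.

Lemma ball_subset r r' : r <= r' -> ball r `<=` ball r'.
Proof. by move=> rr' x; rewrite /ball_d/= => h; exact: le_trans rr'. Qed.

Lemma start_ge0 : 0 <= a.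
Proof.
rewrite leNgt; apply/negP => a0; have /andP[] := vol_a (lexx a).
rewrite (_ : ball a = set0).
  by rewrite /vol esum_set0 lte_fin ltr10.
apply/seteqP; split => // x; rewrite /ball_d/= => h.
by have := le_lt_trans h a0; rewrite ltNge (dist_ge0 graph_w adapted_sigma).
Qed.

Lemma vol_fine r : a <= r -> vol mu (ball r) = (fine (vol mu (ball r)))%:E.
Proof.
move=> ar; rewrite fineK// ge0_fin_numE; first by have /andP[] := vol_a ar.
by have /andP[h _] := vol_a ar; apply: le_trans (ltW h).
Qed.

Lemma vol_gt1 r : a <= r -> 1 < fine (vol mu (ball r)).
Proof. by move=> ar; have /andP[h _] := vol_a ar; rewrite vol_fine// lte_fin in h. Qed.

Lemma log_vol_gt0 r : a <= r -> 0 < L r.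
Proof. by move=> /vol_gt1; exact: ln_gt0. Qed.

Lemma log_vol_incr r r' : a <= r -> r <= r' -> L r <= L r'.
Proof.
move=> ar rr'; have ar' := le_trans ar rr'.
have h1 := vol_gt1 ar; have h2 := vol_gt1 ar'.
rewrite ler_ln ?posrE; [|lra|lra].
by rewrite -lee_fin -!vol_fine//; exact/vol_subset/ball_subset.
Qed.

Lemma balls_finite r : finite_set (ball r).
Proof.
apply: (@sub_finite_set _ _ (ball (Num.max r a))).
  by apply: ball_subset; rewrite le_max lexx.
apply: (ball_finite graph_w mu_inf inf_mass_le).
have ar : a <= Num.max r a by rewrite le_max lexx orbT.
by have /andP[] := vol_a ar.
Qed.

(* The constant 1024, abstracted because conversion would unfold its unary
   numeral. *)
Variable kc : R.
Hypothesis kcE : kc = 2 ^+ 10.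

Let kc_gt0 : 0 < kc. Proof. by rewrite kcE exprn_gt0. Qed.

Variable n0 : nat.
Hypothesis n0_gt0 : (0 < n0)%N.
Hypothesis a_le : a <= 2 ^+ n0.+1.
Hypothesis n0_large : expR (expR 1) <= (2 ^+ n0.+1 : R).
Local Notation Rh := (2 ^+ n0.+1 : R).

Definition growth (r : R) : R := denom (fun r => ln (fine (vol mu (ball r)))) r.
Local Notation M n := (growth (2 ^+ n.+1)).

Lemma pow2_le n n' : (n <= n')%N -> (2 ^+ n : R) <= 2 ^+ n'.
Proof. by move=> nn'; rewrite ler_weXn2l// ler1n. Qed.

Lemma growth_gt0 r : Rh <= r -> 0 < growth r.
Proof. by move=> h; exact: (denom_gt0 log_vol_gt0 a_le n0_large). Qed.

Lemma growth_ge1 r : Rh <= r -> 1 <= growth r.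
Proof. by move=> h; exact: (denom_ge1 log_vol_gt0 a_le n0_large). Qed.

Lemma growth_incr r r' : Rh <= r -> r <= r' -> growth r <= growth r'.
Proof. by move=> h; exact: (denom_incr log_vol_incr a_le n0_large). Qed.

Definition rate_integral (r : R) : R := ratio_integral growth Rh r.

Lemma Rh_ge0 : 0 <= Rh.
Proof. by rewrite exprn_ge0. Qed.

Lemma rate_integral_unbounded (C : R) : exists2 r, Rh <= r & C <= rate_integral r.
Proof.
exact: (ratio_integral_unbounded start_ge0 log_vol_gt0 log_vol_incr vol_div a_le n0_large).
Qed.

Lemma rate_integral_incr r r' : Rh <= r -> r <= r' -> rate_integral r <= rate_integral r'.
Proof. exact: (ratio_integral_incr Rh_ge0 growth_gt0 growth_incr). Qed.

(** The 8 comes from [(2^(n+2) - 2^(n+1)) 2^(n+2) = 8 * 4^n], in the bound for the integral over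
    [[2^(n+1), 2^(n+2)]]. The value of [kc] makes [step n] times [(16 M n / 2^n)^2 / 2] equal to
    [M n], the threshold of the annulus estimate. Below [n0] the growth is not known to be positive,
    hence 0. *)
Definition step n : R :=
  if (n0 <= n)%N then 8 * (2 ^+ n) ^+ 2 / (kc * M n) else 0.
Local Notation total := (total step n0).

Lemma step_ge0 n : 0 <= step n.
Proof.
rewrite /step; case: ifP => // n0n; apply: divr_ge0; first by rewrite mulr_ge0 ?sqr_ge0.
apply: mulr_ge0; first exact: ltW.
by apply/ltW/growth_gt0; exact: pow2_le.
Qed.

Lemma rate_integral_le_total n : (n0 <= n)%N -> rate_integral (2 ^+ n.+1) <= kc * total n.
Proof.
move=> n0n; rewrite -(subnK n0n); move: (n - n0)%N => p.
elim: p => [|p IH].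
  by rewrite add0n /rate_integral ratio_integral_start /total (big_geq (leqnn n0)) mulr0.
rewrite addSn /total big_nat_recr ?leq_addl//= -/(total _) mulrDr.
have Rp : Rh <= 2 ^+ (p + n0).+1 by rewrite pow2_le// ltnS leq_addl.
have pp : (2 ^+ (p + n0).+1 : R) <= 2 ^+ (p + n0).+2 by rewrite pow2_le.
have /andP[_ h] := ratio_integralB Rh_ge0 growth_gt0 growth_incr Rp pp.
have g0 := growth_gt0 Rp.
suff e : (2 ^+ (p + n0).+2 - 2 ^+ (p + n0).+1) * (2 ^+ (p + n0).+2 / M (p + n0)) =
    kc * step (p + n0).
  by rewrite e in h; rewrite /rate_integral in IH *; lra.
rewrite exprS in g0.
rewrite /step leq_addl [2 ^+ (p + n0).+2]exprS [2 ^+ (p + n0).+1]exprS.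
set u := 2 ^+ (p + n0) in g0 *; have k0 := kc_gt0.
by field; rewrite !gt_eqF.
Qed.

Lemma total_unbounded (C : R) : exists2 n, (n0 <= n)%N & C <= total n.
Proof.
have [r Rr hr] := rate_integral_unbounded (kc * C).
have [n hn] := pow2_unbounded r.
have n0n : (n0 <= n)%N.
  rewrite leqNgt; apply/negP => nn0; have := le_trans Rr hn.
  by rewrite ler_eXn2l ?ltr1n// leqNgt ltnS (ltnW nn0).
exists n => //; have := rate_integral_le_total n0n.
have := rate_integral_incr Rr (le_trans hn (pow2_le (leqnSn n))).
by move=> h1 h2; rewrite -(ler_pM2l kc_gt0); lra.
Qed.

Let level_ex j : exists n, j%:R <= total n.
Proof. by have [n _ h] := total_unbounded j%:R; exists n. Qed.

Definition level j : nat := ex_minn (level_ex j).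

Lemma level_ge j : j%:R <= total (level j).
Proof. by rewrite /level; case: ex_minnP. Qed.

Lemma level_min j n : j%:R <= total n -> (level j <= n)%N.
Proof. by rewrite /level; case: ex_minnP => k _; exact. Qed.

(** The ratio of [fast_rate s] to [s^2 / 2], which is the same at all scales; this lets the costs of
    different annuli be added. *)
Definition mix_rate : R := 4 * expR 1 / hold_rate R.

Lemma mix_rate_ge0 : 0 <= mix_rate.
Proof. by rewrite divr_ge0 ?(ltW (hold_rate_gt0 R))// mulr_ge0 ?expR_ge0. Qed.

Definition clock_const : R := mix_rate + slow_rate R.

Lemma clock_const_gt0 : 0 < clock_const.
Proof. by rewrite ltr_pwDr ?mix_rate_ge0 ?slow_rate_gt0. Qed.

(** * Almost sure behavior of the chain *)

Section Chain.
Variables (x0 : V) (m0 : nat).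
Hypothesis m0_ge : (n0 <= m0)%N.
Hypothesis x0_le : D x0 <= 2 ^+ m0.
Context (d : measure_display) (Omega : measurableType d).
Variables (P : probability Omega R) (Y : nat -> Omega -> V) (E : nat -> Omega -> R).
Hypothesis chain : minimal_chain w mu x0 P Y E.

Let slope n : R := 16 * M n / 2 ^+ n.

Definition fast_annulus n : set Omega :=
  crossing w mu sigma (fun x => D x <= 2 ^+ n - 1) (fun x => D x <= 2 ^+ n.+1 - 1)
    (slope n ^+ 2 / 2) (fast_rate (slope n)) (M n) Y E.

Definition slow_clock j : set Omega :=
  crossing w mu sigma pred0 (fun x => D x <= 2 ^+ (level j) - 1)
    (-1) (slow_rate R) (- (total (level j) / 2)) Y E.

Lemma measurable_fast_annulus n : measurable (fast_annulus n).
Proof. exact: measurable_crossing chain. Qed.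

Lemma measurable_slow_clock j : measurable (slow_clock j).
Proof. exact: measurable_crossing chain. Qed.

Let pow_gt0 n : 0 < 2 ^+ n :> R. Proof. by rewrite exprn_gt0. Qed.

Lemma prob_fast_annulus n : (m0 <= n)%N ->
  (P (fast_annulus n) <=
    (annulus_const c0 / ln 2 ^+ 2 * (n.+1%:R ^+ 2)^-1)%:E)%E.
Proof.
move=> m0n; have n0n := leq_trans m0_ge m0n.
have RM : Rh <= 2 ^+ n.+1 by rewrite pow2_le.
have g1 := growth_ge1 RM.
have s0 : 0 < slope n by rewrite divr_gt0// mulr_gt0//; lra.
have q0 : 0 < (2 ^+ n / 2 : R) by rewrite divr_gt0.
have sq : slope n * (2 ^+ n / 2) = 8 * M n.
  by rewrite /slope; field; rewrite gt_eqF.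
have fb : finite_set (ball (2 ^+ n.+1 - 1 + 1)) by exact: balls_finite.
have vl : \sum_(x <- fset_set (ball (2 ^+ n.+1 - 1 + 1))) mu x <= expR (M n).
  have e : (2 ^+ n.+1 - 1 + 1 : R) = 2 ^+ n.+1 by rewrite subrK.
  have aR := le_trans a_le RM.
  rewrite -lee_fin -(vol_finite graph_w fb) e vol_fine// lee_fin.
  rewrite -[leLHS]lnK ?posrE; last by have := vol_gt1 aR; lra.
  by rewrite ler_expR /growth /denom lerDl; have := lnln_ge1 n0_large RM; lra.
have x0' : D x0 <= 2 ^+ n - 1 + 1 by rewrite subrK; apply: le_trans x0_le (pow2_le m0n).
(* Half of the annulus serves as [q]; the overshoot and the shift of the radii by 1 fit into the
   rest as soon as [2^n >= 2], which [n0 > 0] ensures. *)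
have gp : 2 ^+ n - 1 + 1 <= 2 ^+ n.+1 - 1 - 2 ^+ n / 2 :> R.
  have n1 : (2 ^+ 1 : R) <= 2 ^+ n by rewrite pow2_le// (leq_trans n0_gt0).
  by rewrite exprS; rewrite expr1 in n1; lra.
have := @annulus_prob _ _ w mu sigma xbar graph_w adapted_sigma c0 (2 ^+ n.+1 - 1)
  (2 ^+ n / 2) (M n) (slope n) mu_inf inf_mass_le fb vl g1 q0 s0 sq _ _ P Y E x0
  (2 ^+ n - 1) chain x0' gp.
move=> /le_trans; apply; rewrite lee_fin -mulrA ler_wpM2l ?sqrtr_ge0//.
have ll := lnln_ge1 n0_large RM.
have L0 := log_vol_gt0 (le_trans a_le RM).
have ln2 : 0 < ln 2 :> R by rewrite ln_gt0// ltr1n.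
have lnp : ln (2 ^+ n.+1) = n.+1%:R * ln 2 :> R by rewrite lnXn// mulr_natl.
have lp0 : 0 < ln (2 ^+ n.+1) :> R by rewrite lnp mulr_gt0.
(* Only the [log log] part of [M n] is kept: by itself it yields [(log 2^(n+1))^-2], summable in
   [n]. *)
apply: (@le_trans _ _ (expR (- (2 * ln (ln (2 ^+ n.+1)))))).
  by rewrite ler_expR lerN2 ler_pM2l// /growth /denom lerDr ltW.
rewrite expRN mulr_natl mulr2n expRD lnK ?posrE// lnp le_eqVlt; apply/orP; left; apply/eqP.
by field; rewrite !gt_eqF.
Qed.

(** [total (level j) >= j] gives [exp(-j/2)], and squaring [exp(j/4) >= (j + 1)/4] puts this in the
    summable form. *)
Lemma prob_slow_clock j : (P (slow_clock j) <= (16 * (j.+1%:R ^+ 2)^-1)%:E)%E.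
Proof.
apply: le_trans (slow_prob graph_w adapted_sigma chain _ _) _.
rewrite lee_fin; have h := level_ge j.
apply: (@le_trans _ _ (expR (- (j%:R / 2)))).
  by rewrite ler_expR; lra.
have j0 : 0 <= j%:R :> R by rewrite ler0n.
have h1 : j.+1%:R / 4 <= expR (j%:R / 4) :> R.
  by have := expR_ge1Dx (j%:R / 4 : R); rewrite -[j.+1%:R]natr1; lra.
have h2 : (j.+1%:R / 4) ^+ 2 <= expR (j%:R / 4) ^+ 2 :> R.
  by rewrite ler_sqr ?nnegrE ?expR_ge0 ?divr_ge0.
have e : expR (j%:R / 4) ^+ 2 = expR (j%:R / 2) :> R.
  by rewrite expr2 -expRD; congr expR; field.
rewrite e in h2; rewrite expRN.
have -> : 16 * (j.+1%:R ^+ 2)^-1 = ((j.+1%:R / 4) ^+ 2)^-1 :> R.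
  by field; rewrite gt_eqF.
by rewrite lef_pV2 ?posrE ?expR_gt0 ?exprn_gt0 ?divr_gt0.
Qed.

(** The shift by [m0] discards the annuli that the starting vertex may already have passed. *)
Definition good_from m : set Omega := [set om |
  holds_positive E om /\
  ((forall n, (m <= n)%N -> ~ fast_annulus (n + m0) om) /\
   (forall j, (m <= j)%N -> ~ slow_clock j om))].

Lemma measurable_good_from m : measurable (good_from m).
Proof.
apply: measurable_and; first exact: measurable_holds_positive chain.
apply: measurable_and.
  apply: (@measurable_forall _ _ (fun n => [set om | (m <= n)%N -> ~ fast_annulus (n + m0) om])) => n.
  by apply: measurable_imply; apply: measurableC; exact: measurable_fast_annulus.
apply: (@measurable_forall _ _ (fun n => [set om | (m <= n)%N -> ~ slow_clock n om])) => n.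
by apply: measurable_imply; apply: measurableC; exact: measurable_slow_clock.
Qed.

Lemma measurable_good : measurable [set om | exists m, good_from m om].
Proof. by apply: measurable_exists => m; exact: measurable_good_from. Qed.

Lemma good_full : P [set om | exists m, good_from m om] = 1%E.
Proof.
have C0 : 0 <= annulus_const c0 / ln 2 ^+ 2 by rewrite divr_ge0 ?sqrtr_ge0 ?sqr_ge0.
have h1 : P [set om | exists m, forall n, (m <= n)%N -> ~ fast_annulus (n + m0) om] = 1%E.
  apply: (borel_cantelli_inv_sqr C0) => n; first exact: measurable_fast_annulus.
  apply: le_trans (prob_fast_annulus (leq_addl n m0)) _.
  rewrite lee_fin ler_wpM2l// lef_pV2 ?posrE ?exprn_gt0//.
  by rewrite ler_sqr ?nnegrE// ler_nat ltnS leq_addr.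
have h2 : P [set om | exists m, forall n, (m <= n)%N -> ~ slow_clock n om] = 1%E.
  apply: (@borel_cantelli_inv_sqr _ _ _ P _ 16) => // n.
    exact: measurable_slow_clock.
  exact: prob_slow_clock.
have m1 (F : nat -> set Omega) : (forall n, measurable (F n)) ->
    measurable [set om | exists m, forall n, (m <= n)%N -> ~ F n om].
  move=> mF.
  apply: (@measurable_exists _ _ (fun m => [set om | forall n, (m <= n)%N -> ~ F n om])) => m.
  apply: (@measurable_forall _ _ (fun n => [set om | (m <= n)%N -> ~ F n om])) => n.
  by apply: measurable_imply; exact: measurableC.
have mp := measurable_holds_positive chain.
have mA := m1 _ (fun n => measurable_fast_annulus (n + m0)).
have mB := m1 _ measurable_slow_clock.
have := prob_and1 mp (measurableI _ _ mA mB) (holds_positive_full graph_w chain)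
  (prob_and1 mA mB h1 h2).
move=> PA; apply/eqP; rewrite eq_le; apply/andP; split.
  by apply: probability_le1; exact: measurable_good.
rewrite -PA; apply: prob_le.
- by apply: measurableI => //; exact: measurableI.
- exact: measurable_good.
move=> om [hp [[m hm] [m' hm']]]; exists (maxn m m'); split => //; split => n.
  by rewrite geq_max => /andP[h _]; exact: hm.
by rewrite geq_max => /andP[_ h]; exact: hm'.
Qed.

Lemma jump_time_clock k om :
  jump_time w mu Y E k om = clock w mu (Y^~ om) (E^~ om) k.
Proof.
rewrite /jump_time /clock big_mkord; apply: eq_bigr => j _.
by rewrite jump_rateV mulrC.
Qed.

Lemma jump_time_incr om k k' : holds_positive E om -> (k <= k')%N ->
  jump_time w mu Y E k om <= jump_time w mu Y E k' om.
Proof. by move=> hp kk'; rewrite !jump_time_clock; exact: clock_incr. Qed.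

Lemma jump_time_lower m om n k : good_from m om -> (m + m0)%:R <= total n ->
  leaves D (Y^~ om) n k ->
  (total n - 1) / 2 - total (m + m0) <= clock_const * jump_time w mu Y E k om.
Proof.
move=> [hp [hB hA]] mT lk; rewrite jump_time_clock.
apply: (@clock_lower _ _ w mu sigma graph_w D step (Y^~ om) (E^~ om) n0 (m + m0)
  mix_rate (slow_rate R) hp step_ge0 mix_rate_ge0 (ltW (slow_rate_gt0 R)) _ _ level
  level_ge level_min _ n k mT lk).
- exact: leq_trans m0_ge (leq_addl _ _).
- move=> p mp i l il li ll.
  have n0p : (n0 <= p)%N by apply: leq_trans mp; exact: leq_trans m0_ge (leq_addl _ _).
  have m0p : (m0 <= p)%N := leq_trans (leq_addl m m0) mp.
  have nb : ~ fast_annulus p om.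
    have mp' : (m <= p - m0)%N by rewrite leq_subRL// addnC.
    by have := hB _ mp'; rewrite subnK.
  have RM : Rh <= 2 ^+ p.+1 by rewrite pow2_le.
  have g0 := growth_gt0 RM.
  rewrite leNgt; apply/negP => h; apply: nb; exists i, l; split => //; split => //; split => //.
  have -> : cost w mu sigma (slope p ^+ 2 / 2) (fast_rate (slope p)) Y E i l om =
      slope p ^+ 2 / 2 * mixed_cost w mu sigma (Y^~ om) (E^~ om) mix_rate i l.
    rewrite /cost /mixed_cost mulr_sumr; apply: eq_bigr => j _.
    rewrite /fast_rate /mix_rate; field.
    by rewrite gt_eqF// hold_rate_gt0.
  have -> : M p = slope p ^+ 2 / 2 * step p.
    by rewrite /slope /step n0p kcE; field; rewrite !gt_eqF.
  by rewrite ler_wpM2l ?(ltW h)// divr_ge0 ?sqr_ge0.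
- move=> j mj l ll; have nb := hA j (leq_trans (leq_addr _ _) mj).
  rewrite leNgt; apply/negP => h; apply: nb; exists 0%N, l; split => //; split => //; split => //.
  rewrite /cost.
  rewrite (eq_bigr (fun j => - sigma (Y j om) (Y j.+1 om) ^+ 2 +
      slow_rate R * (mean_hold w mu (Y j om) * E j om))); last first.
    by move=> i _; rewrite mulN1r mulrA.
  rewrite big_split/= sumrN -mulr_sumr; move: h; rewrite /clock; lra.
Qed.

(** A trajectory leaving every ball takes infinite time by [jump_time_lower]. One that stays in a
    ball meets finitely many vertices, so its mean holds are bounded below while the sum of the
    exponential variables diverges. *)
Lemma no_explosion_at : no_explosion w mu P Y E.
Proof.
exists ([set om | exists m, good_from m om] `&`
  [set om | forall l : nat, exists K, (l%:R < \sum_(j < K.+1) E j om)%R]).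
have mS : measurable [set om | forall l : nat, exists K, (l%:R < \sum_(j < K.+1) E j om)%R].
  apply: (@measurable_forall _ _ (fun l : nat => [set om | exists K, (l%:R < \sum_(j < K.+1) E j om)%R])) => l.
  apply: (@measurable_exists _ _ (fun K => [set om | (l%:R < \sum_(j < K.+1) E j om)%R])) => K.
  by apply: measurable_cst_lt; apply: measurable_sum => j; exact: measurable_hold chain j.
split.
- by apply: measurableI => //; exact: measurable_good.
- apply: prob_and1 => //; [exact: measurable_good|exact: good_full|].
  exact: (sum_hold_diverges graph_w chain).
move=> om [[m gm] hS]; apply/eqyP => A A0.
suff [k hk] : exists k, A <= jump_time w mu Y E k om.
  apply: (@le_trans _ _ (jump_time w mu Y E k om)%:E); first by rewrite lee_fin.
  by apply: ereal_sup_ubound; exists k.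
have hp : holds_positive E om by case: gm.
have [exits|/existsNP[n stay]] := pselect (forall n, exists k, leaves D (Y^~ om) n k).
  have [n n0n hn] := total_unbounded ((m + m0)%:R + 1 + 2 * (total (m + m0) + clock_const * A)).
  have [k lk] := exits n; exists k.
  have T0 : 0 <= total (m + m0) by apply: sumr_ge0 => j _; exact: step_ge0.
  have cA : 0 <= clock_const * A by rewrite mulr_ge0 ?ltW// clock_const_gt0.
  have mT : (m + m0)%:R <= total n by lra.
  have hJ := jump_time_lower gm mT lk.
  have m00 : 0 <= (m + m0)%:R :> R by rewrite ler0n.
  by rewrite -(ler_pM2l clock_const_gt0); lra.
have inball j : D (Y j om) <= 2 ^+ n - 1.
  apply: contrapT => /negP h; apply: stay.
  have ex : exists i, ~~ (D (Y i om) <= 2 ^+ n - 1) by exists j.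
  exists (ex_minn ex); case: ex_minnP => i ni mini; split => // l li.
  by apply: contraLR li => /mini; rewrite -leqNgt.
have [eta eta0 heta] := fset_lower_bound (fset_set (ball (2 ^+ n - 1))) (mean_hold_gt0 graph_w).
have [K hK] := hS (Num.bound (A / eta)).
exists K.+1; rewrite jump_time_clock /clock big_mkord.
apply: (@le_trans _ _ (eta * \sum_(j < K.+1) E j om)).
  rewrite mulrC -ler_pdivrMr//; apply: le_trans (ltW hK).
  by apply/ltW/archi_boundP; rewrite divr_ge0 ?ltW.
rewrite mulr_sumr; apply: ler_sum => j _; apply: ler_wpM2r; first exact/ltW/hp.
apply: heta; rewrite in_fset_set; last exact: balls_finite.
by apply/mem_set; exact: inball.
Qed.

(** The 4 is twice the 2 lost in [clock_lower]; the margin absorbs the random additive constant at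
    large times. *)
Definition rate_const : R := (4 * kc * clock_const)^-1.

Lemma rate_const_gt0 : 0 < rate_const.
Proof. by rewrite invr_gt0 mulr_gt0 ?clock_const_gt0// mulr_gt0. Qed.

Lemma upper_rate (psi_inv : R -> R) :
  (forall t, 0 <= t -> Rh <= psi_inv t /\ rate_const * rate_integral (psi_inv t) = t) ->
  upper_rate_function w mu dist xbar P Y E psi_inv.
Proof.
move=> hinv.
have c_gt0 := rate_const_gt0.
have lower t r : 0 <= t -> Rh <= r -> rate_const * rate_integral r <= t -> r <= psi_inv t.
  move=> t0 Rr ht; have [Ri e] := hinv _ t0; rewrite leNgt; apply/negP => h.
  have : rate_integral (psi_inv t) < rate_integral r.
    exact: (ratio_integral_lt Rh_ge0 growth_gt0 growth_incr).
  by rewrite -(ltr_pM2l c_gt0) e; lra.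
have psi_ge0 r : Rh <= r -> 0 <= rate_const * rate_integral r.
  move=> Rr; rewrite mulr_ge0 ?(ltW c_gt0)// -(ratio_integral_start growth Rh).
  exact: rate_integral_incr.
split.
  move=> s t s0 st; have t0 := le_trans s0 st.
  have [Rs es] := hinv _ s0; have [Rt et] := hinv _ t0.
  split; first exact: le_trans Rs.
  by apply: lower => //; rewrite es.
(* A scale past which the additive loss is at most half of the main term: [(T - 1)/2 - K >= T/4]
   once [T >= 2 + 4 K], with [K = total (m + m0)]. *)
have /choice[n1 hn1] : forall m, exists n, (n0 <= n)%N /\
    (m + m0)%:R + 2 + 4 * total (m + m0) <= total n.
  by move=> m; have [n ? ?] := total_unbounded ((m + m0)%:R + 2 + 4 * total (m + m0)); exists n.
have [first [mfirst hfirst]] := measurable_first_index measurable_good_from.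
pose tau m := rate_const * rate_integral (2 ^+ (n1 m).+1).
exists (fun om => tau (first om)); split; first exact: measurable_countable_valued.
have [B [mB PB hB]] := no_explosion_at.
exists ([set om | exists m, good_from m om] `&` B); split.
- by apply: measurableI => //; exact: measurable_good.
- by apply: prob_and1 => //; [exact: measurable_good|exact: good_full].
move=> om [/hfirst gm Bom]; rewrite (hB _ Bom); split; first exact: ltry.
move: (first om) gm => m gm t x tt _ [i [Jit _ Yx]].
have hp : holds_positive E om by case: gm.
have [n0n1 Tn1] := hn1 m.
have Rn1 : Rh <= 2 ^+ (n1 m).+1 by rewrite pow2_le.
have t0 : 0 <= t by apply: le_trans tt; exact: psi_ge0.
rewrite (distC graph_w adapted_sigma) -Yx.
(* Near [xbar], [t >= tau] suffices. Otherwise let [2^(n+1)] be the least dyadic radius containing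
   the position: the ball of radius [2^n - 1] was left by time [t], and the exit time bound gives
   [psi (2^(n+1)) <= t]. *)
have [near|far] := leP (D (Y i om)) (2 ^+ (n1 m).+1).
  by apply: le_trans near _; apply: lower.
have ex := pow2_unbounded (D (Y i om)).
pose p := ex_minn ex.
have [Dp minp] : D (Y i om) <= 2 ^+ p /\ forall n, D (Y i om) <= 2 ^+ n -> (p <= n)%N.
  by rewrite /p; case: ex_minnP.
have n1p : ((n1 m).+1 < p)%N.
  rewrite ltnNge; apply/negP => h; have := lt_le_trans far Dp.
  by rewrite ltNge pow2_le.
have [n pn] : exists n, p = n.+1 by exists p.-1; rewrite prednK// (leq_ltn_trans _ n1p).
rewrite pn in Dp n1p minp.
have Dn : 2 ^+ n < D (Y i om).
  by rewrite ltNge; apply/negP => /minp; rewrite ltnn.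
have [k ki lk] : exists2 k, (k <= i)%N & leaves D (Y^~ om) n k.
  have ex' : exists i, ~~ (D (Y i om) <= 2 ^+ n - 1) by exists i; rewrite -ltNge; lra.
  exists (ex_minn ex'); case: ex_minnP => k nk mink; first by apply: mink; rewrite -ltNge; lra.
  by split => // l lk; apply: contraLR lk => /mink; rewrite -leqNgt.
have n1n : (n1 m <= n)%N by rewrite ltnS in n1p; exact: ltnW.
have TT : total (n1 m) <= total n by exact: (total_incr n0 step_ge0 n1n).
have T0 : 0 <= total (m + m0) by apply: sumr_ge0 => j _; exact: step_ge0.
have m00 : 0 <= (m + m0)%:R :> R by rewrite ler0n.
have mT : (m + m0)%:R <= total n by lra.
have hJ := jump_time_lower gm mT lk.
have hI := rate_integral_le_total (leq_trans n0n1 n1n).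
have Jk := le_trans (jump_time_incr hp ki) Jit.
apply: le_trans Dp _; apply: lower => //; first by rewrite pow2_le// ltnS (leq_trans n0n1).
apply: le_trans Jk; rewrite -(ler_pM2l clock_const_gt0).
have -> : clock_const * (rate_const * rate_integral (2 ^+ n.+1)) =
    rate_integral (2 ^+ n.+1) / kc / 4.
  by rewrite /rate_const; field; rewrite !gt_eqF// clock_const_gt0.
have hI' : rate_integral (2 ^+ n.+1) / kc <= total n by rewrite ler_pdivrMr// mulrC.
by lra.
Qed.

End Chain.

End Assembly.

Theorem theorem1p7 (R : realType) (V : countType)
  (w : V -> V -> R) (mu : V -> R) (sigma : V -> V -> R) (xbar : V) :
  simple_weighted_graph w mu ->
  adapted_weight w mu sigma ->
  0 < inf [set mu x | x in [set: V]] ->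
  (exists a : R,
     (forall r, a <= r ->
        (1 < vol mu (ball_d (adapted_dist w sigma) xbar r) < +oo)%E) /\
     (\int[lebesgue_measure]_(r in `[a, +oo[%classic)
        (r / ln (fine (vol mu (ball_d (adapted_dist w sigma) xbar r))))%:E
      = +oo)%E) ->
  (* (1) conservativeness: for every starting point x, P_x(zeta < oo) = 0 *)
  (forall (x : V) (d : measure_display) (Omega : measurableType d)
          (P : probability Omega R) (Y : nat -> Omega -> V)
          (E : nat -> Omega -> R),
     minimal_chain w mu x P Y E -> no_explosion w mu P Y E) /\
  (* (2) upper rate function psi^{-1} *)
  (exists (c Rhat : R), 0 < c /\ 1 <= Rhat /\
     let psi := fun Rr : R =>
       c * Rintegral lebesgue_measure `[Rhat, Rr]%classic
         (fun r => r / (ln (fine (vol mu (ball_d (adapted_dist w sigma) xbar r)))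
                        + ln (ln r))) in
     (* psi is an increasing bijection [Rhat, oo) -> [0, oo), so psi^{-1}
        is well defined on [0, oo) *)
     (forall r1 r2, Rhat <= r1 -> r1 < r2 -> psi r1 < psi r2) /\
     (forall t, 0 <= t -> exists r, Rhat <= r /\ psi r = t) /\
     (forall psi_inv : R -> R,
        (forall t, 0 <= t -> Rhat <= psi_inv t /\ psi (psi_inv t) = t) ->
        forall (d : measure_display) (Omega : measurableType d)
               (P : probability Omega R) (Y : nat -> Omega -> V)
               (E : nat -> Omega -> R),
          minimal_chain w mu xbar P Y E ->
          upper_rate_function w mu (adapted_dist w sigma) xbar P Y E psi_inv)).
Proof.
move=> gw ad mi [a [va vd]].
have [k1 hk1] := pow2_unbounded a.
have [k2 hk2] := pow2_unbounded (expR (expR 1) : R).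
pose n0 := (k1 + k2).+1.
have a_le : a <= 2 ^+ n0.+1.
  by apply: le_trans hk1 (pow2_le _ _); rewrite !leqW// leq_addr.
have n0_large : expR (expR 1) <= 2 ^+ n0.+1 :> R.
  by apply: le_trans hk2 (pow2_le _ _); rewrite !leqW// leq_addl.
have start x : exists2 m0, (n0 <= m0)%N & adapted_dist w sigma xbar x <= 2 ^+ m0.
  have [m hm] := pow2_unbounded (adapted_dist w sigma xbar x).
  exists (m + n0)%N; first exact: leq_addl.
  by apply: le_trans hm (pow2_le _ _); exact: leq_addr.
split.
  move=> x d Omega P Y E ch; have [m0 n0m xm] := start x.
  exact: (no_explosion_at gw ad mi va vd erefl (ltn0Sn _) a_le n0_large n0m xm ch).
exists (rate_const (2 ^+ 10 : R)), (2 ^+ n0.+1).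
have c0 := rate_const_gt0 (erefl (2 ^+ 10 : R)).
have Rh0 := @Rh_ge0 R n0.
have g0 := growth_gt0 va a_le n0_large.
have gi := growth_incr va a_le n0_large.
split=> //; split; first by rewrite exprn_ege1// ler1n.
split.
  move=> r1 r2 R1 r12; rewrite ltr_pM2l//.
  exact: (ratio_integral_lt Rh0 g0 gi).
split.
  move=> t t0.
  have [r Rr hr] := rate_integral_unbounded gw ad va vd a_le n0_large (t / rate_const (2 ^+ 10)).
  have tc : 0 <= t / rate_const (2 ^+ 10) by rewrite divr_ge0// ltW.
  have [r' Rr' e] := ratio_integral_onto Rh0 g0 gi Rr tc hr.
  by exists r'; split => //; rewrite -[RHS](divfK (lt0r_neq0 c0)) -e [RHS]mulrC.
move=> psi_inv hinv d Omega P Y E ch; have [m0 n0m xm] := start xbar.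
exact: (upper_rate gw ad mi va vd erefl (ltn0Sn _) a_le n0_large n0m xm ch hinv).
Qed.
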